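(* Let $p>1$, let $X$ be a separable Banach space with property $(M_p)$, and let $T\colon X\to X$ be a bounded linear operator. Then: \begin{itemize} \item $m_{\min}(T)<1$ if and only if $m_{\min}(T)=0$ if and only if $\|T\|=\|T\|_e$; \item $m_{\max}(T)>0$ if and only if $m_{\max}(T)=1$ if and only if $T$ is norm-attaining. \end{itemize} The result is illustrated by the following scheme of partitions of the set $\mathcal L(X)$ of bounded linear operators on $X$. \begin{itemize} \item The partition of $\mathcal L(X)$ into the operators that are not norm-attaining and those that are norm-attaining coincides with the partition into $m_{\max}(T)=0$ and $m_{\max}(T)>0$, and with the partition into $m_{\max}(T)=0$ and $m_{\max}(T)=1$. \item The partition of $\mathcal L(X)$ into the operators with $\|T\|=\|T\|_e$ and those with $\|T\|>\|T\|_e$ coincides with the partition into $m_{\min}(T)<1$ and $m_{\min}(T)=1$, and with the partition into $m_{\min}(T)=0$ and $m_{\min}(T)=1$. \item If $T$ is not norm-attaining, then $\|T\|=\|T\|_e$ (equivalently, if $\|T\|>\|T\|_e$, then $T$ is norm-attaining). Hence each $T$ belongs to exactly one of three classes: $T$ not norm-attaining (and $\|T\|=\|T\|_e$); $T$ norm-attaining with $\|T\|=\|T\|_e$; $T$ norm-attaining with $\|T\|>\|T\|_e$. \end{itemize}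
   Context: For a Banach space $X$, $B_X$ is the closed unit ball, $\partial B_X$ the unit sphere, $\mathcal L(X)$ the bounded linear operators on $X$ and $\mathcal K(X)$ the compact operators on $X$. The essential norm of $T\in\mathcal L(X)$ is $\|T\|_e=\inf_{K\in\mathcal K(X)}\|T-K\|$. $T$ is norm-attaining if there is $x\in B_X$ with $\|Tx\|=\|T\|$. M-ideals and property $(M_p)$: a closed subspace $Y$ of a Banach space $E$ is an M-ideal in $E$ if there is a subspace $Z\subset E^*$ with $E^*=Z\oplus_1 Y^\perp$, i.e. $E^*=Z\oplus Y^\perp$ and $\|z+w\|=\|z\|+\|w\|$ for $z\in Z$, $w\in Y^\perp$. Here $Y^\perp$ is the annihilator of $Y$ in $E^*$. For $p>1$, $X\oplus_p X$ is the direct sum with norm $\|(x,y)\|=(\|x\|^p+\|y\|^p)^{1/p}$. A separable Banach space $X$ has property $(M_p)$ if $\mathcal K(X\oplus_p X)$ is an M-ideal in $\mathcal L(X\oplus_p X)$. (Every space with $(M_p)$, $p>1$, is reflexive.) Maximizing sequences and weak cluster points: for $T\in\mathcal L(X)$, $\mathcal{MS}(T)$ is the set of sequences $(x_n)\subset\partial B_X$ with $\lim_n\|Tx_n\|=\|T\|$, and $$\mathcal{WC}(T)=\bigcup_{(x_n)\in\mathcal{MS}(T)}\ \bigcap_{k}\overline{\{x_n:n\ge k\}}^{\,w},$$ where $\overline{\,\cdot\,}^{\,w}$ denotes closure in the weak topology. Define $$m_{\min}(T)=\inf\{\|x\|:x\in\mathcal{WC}(T)\},\qquad m_{\max}(T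)=\sup\{\|x\|:x\in\mathcal{WC}(T)\}.$$
   Formalization: X is assumed nonzero, and the statements about m_min exclude T=0 on a finite-dimensional X: there ‖T‖=‖T‖_e=0 but m_min(T)=1, and for X={0} the set WC(T) is empty, so the claims fail as printed. *)

(* Defs.v *)
From HB Require Import structures.
From mathcomp Require Import all_boot all_order all_algebra.
From mathcomp Require Import all_classical all_reals all_analysis.
From mathcomp Require Import complex.

Set Implicit Arguments.
Unset Strict Implicit.
Unset Printing Implicit Defensive.

Import Order.TTheory GRing.Theory Num.Theory.
Import numFieldNormedType.Exports.

Local Open Scope classical_set_scope.
Local Open Scope ring_scope.

(* Banach spaces are taken over the real or over the complex numbers; the kind
   of scalars is a parameter, so that both cases are treated at once. *)
Variant scalar_kind := RealScalars | ComplexScalars.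

Definition scalars (R : realType) (s : scalar_kind) : numFieldType :=
  match s with RealScalars => R : numFieldType
             | ComplexScalars => R[i] : numFieldType end.

Section scalars.
Context {R : realType} {s : scalar_kind}.
Local Notation K := (scalars R s).

Definition re_part : K -> R :=
  match s return scalars R s -> R with
  | RealScalars => fun x => x
  | ComplexScalars => fun x => complex.Re x
  end.

Definition of_real : R -> K :=
  match s return R -> scalars R s with
  | RealScalars => fun x => x
  | ComplexScalars => fun x => real_complex R x
  end.

(* The library norm of a normedModType K has values in K (nonnegative complex
   numbers when K = R[i]); nrm is the same norm with values in R. *)
Definition nrm (V : normedZmodType K) (x : V) : R := re_part `|x|.

Lemma of_realK : cancel of_real re_part.
Proof. by rewrite /of_real /re_part; case: s. Qed.

Lemma of_realD (a b : R) : of_real (a + b) = of_real a + of_real b.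
Proof. by rewrite /of_real; case: s => //; rewrite rmorphD. Qed.

Lemma of_realM (a b : R) : of_real (a * b) = of_real a * of_real b.
Proof. by rewrite /of_real; case: s => //; rewrite rmorphM. Qed.

Lemma of_real0 : of_real 0 = 0.
Proof. by rewrite /of_real; case: s => //; rewrite rmorph0. Qed.

Lemma ler_of_real (a b : R) : (of_real a <= of_real b) = (a <= b).
Proof. by rewrite /of_real; case: s => //; rewrite lecR. Qed.

Lemma nrmE (V : normedZmodType K) (x : V) : of_real (nrm x) = `|x|.
Proof.
have : `|x| \is Num.real by apply: normr_real.
rewrite /nrm; move: `|x|; rewrite /of_real /re_part.
by case: s => // z; exact: RRe_real.
Qed.

Lemma nrm_ge0 (V : normedZmodType K) (x : V) : 0 <= nrm x.
Proof. by rewrite -ler_of_real of_real0 nrmE. Qed.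

Lemma nrm0 (V : normedZmodType K) : nrm (0 : V) = 0.
Proof. by rewrite /nrm normr0 -of_real0 of_realK. Qed.

Lemma nrm0_eq0 (V : normedZmodType K) (x : V) : nrm x = 0 -> x = 0.
Proof.
by move=> x0; apply/eqP; rewrite -normr_eq0 -nrmE x0 of_real0.
Qed.

Lemma ler_nrmD (V : normedZmodType K) (x y : V) :
  nrm (x + y) <= nrm x + nrm y.
Proof. by rewrite -ler_of_real of_realD !nrmE ler_normD. Qed.

Lemma nrmZ (V : normedModType K) (a : K) (x : V) :
  nrm (a *: x) = nrm a * nrm x.
Proof.
have := normrZ a x; rewrite -!nrmE -of_realM => /(congr1 re_part).
by rewrite !of_realK.
Qed.

Lemma nrmM (a b : K) : nrm (a * b) = nrm a * nrm b.
Proof.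
have := normrM a b; rewrite -!nrmE -of_realM => /(congr1 re_part).
by rewrite !of_realK.
Qed.

Lemma nrm1 : nrm (1 : K) = 1.
Proof. by rewrite /nrm normr1 /re_part; case: s. Qed.

Lemma nrm_of_real (r : R) : nrm (of_real r : K) = `|r|.
Proof.
rewrite /nrm /of_real /re_part; case: s => //=.
by rewrite expr0n /= addr0 sqrtr_sqr.
Qed.

End scalars.

Section bounded_operators.
Context {R : realType} {s : scalar_kind}.
Local Notation K := (scalars R s).
Variables X Y : normedModType K.

Definition bounded_linear : {pred X -> Y} :=
  mem [set f : X -> Y | linear f /\ exists M : R, forall x, nrm (f x) <= M * nrm x].

Record bop := Bop { bop_fun :> X -> Y ; bopP : bop_fun \in bounded_linear }.

HB.instance Definition _ := [isSub for bop_fun].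
HB.instance Definition _ := [Choice of bop by <:].

Lemma bounded_linear_submod : submod_closed bounded_linear.
Proof.
split=> [|a f g]; rewrite !inE /=.
  split=> [b x y /=|]; first by rewrite scaler0 addr0.
  by exists 0 => x; rewrite mul0r [X in nrm X](_ : _ = 0)// nrm0.
move=> [lf [M fM]] [lg [N gN]]; split=> [b x y /=|].
  rewrite -[LHS]/(a *: f (b *: x + y) + g (b *: x + y)).
  rewrite -[RHS]/(b *: (a *: f x + g x) + (a *: f y + g y)).
  by rewrite lf lg !scalerDr !scalerA [b * a]mulrC addrACA.
exists (nrm a * M + N) => x /=.
rewrite mulrDl (le_trans (ler_nrmD _ _))// lerD//.
by rewrite nrmZ -mulrA ler_wpM2l// nrm_ge0.
Qed.

HB.instance Definition _ :=
  GRing.isSubmodClosed.Build K (X -> Y) bounded_linear bounded_linear_submod.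
HB.instance Definition _ := [SubChoice_isSubLmodule of bop by <:].

Implicit Types T S : bop.

Lemma bop_linear T : linear T.
Proof. by have := bopP T; rewrite inE => -[]. Qed.

HB.instance Definition _ T := GRing.isLinear.Build K X Y _ T (bop_linear T).

Lemma bop_bounded T : exists M : R, forall x, nrm (T x) <= M * nrm x.
Proof. by have := bopP T; rewrite inE => -[]. Qed.

Definition opnorm T : R := sup [set nrm (T x) | x in [set x | nrm x <= 1]].

Lemma opnorm_has_sup T :
  has_sup [set nrm (T x) | x in [set x | nrm x <= 1]].
Proof.
split; first by exists (nrm (T 0)); exists 0 => //=; rewrite nrm0.
have [M TM] := bop_bounded T; exists `|M| => _ [x /= x1 <-].
rewrite (le_trans (TM x))// (le_trans (ler_norm _))// normrM.
by rewrite ler_piMr// ger0_norm ?nrm_ge0.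
Qed.

Lemma le_opnorm_ball T x : nrm x <= 1 -> nrm (T x) <= opnorm T.
Proof. by move=> x1; apply: sup_upper_bound; [exact: opnorm_has_sup|exists x]. Qed.

Lemma opnorm_le T (M : R) :
  (forall x, nrm x <= 1 -> nrm (T x) <= M) -> opnorm T <= M.
Proof.
move=> TM; apply: ge_sup; first by case: (opnorm_has_sup T).
by move=> _ [x /= x1 <-]; exact: TM.
Qed.

Lemma opnorm_ge0 T : 0 <= opnorm T.
Proof. by rewrite (le_trans (nrm_ge0 (T 0)))// le_opnorm_ball// nrm0. Qed.

Lemma le_opnorm T x : nrm (T x) <= opnorm T * nrm x.
Proof.
have [x0|x0] := eqVneq (nrm x) 0.
  by rewrite (nrm0_eq0 x0) linear0 !nrm0 mulr0.
have xgt0 : 0 < nrm x by rewrite lt0r x0 nrm_ge0.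
rewrite -ler_pdivrMr// mulrC.
have := @le_opnorm_ball T (of_real ((nrm x)^-1) *: x).
rewrite linearZ /= !nrmZ nrm_of_real ger0_norm ?invr_ge0 ?(ltW xgt0)//.
by rewrite mulVf//; apply.
Qed.

Lemma ler_opnormD T S :
  of_real (opnorm (T + S)) <= of_real (opnorm T) + of_real (opnorm S) :> K.
Proof.
rewrite -of_realD ler_of_real; apply: opnorm_le => x x1.
rewrite (le_trans (ler_nrmD (T x) (S x)))// lerD// ?le_opnorm_ball//.
Qed.

Lemma opnormZ_le (a : K) T : opnorm (a *: T) <= nrm a * opnorm T.
Proof.
apply: opnorm_le => x x1; rewrite [X in nrm X](_ : _ = a *: T x)// nrmZ.
by rewrite ler_wpM2l ?nrm_ge0 ?le_opnorm_ball.
Qed.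

Lemma opnormZ (a : K) T :
  of_real (opnorm (a *: T)) = `|a| * of_real (opnorm T).
Proof.
rewrite -nrmE -of_realM; congr of_real; apply/eqP.
rewrite eq_le opnormZ_le /=.
have [->|a0] := eqVneq a 0; first by rewrite nrm0 mul0r opnorm_ge0.
have -> : nrm a * opnorm T = nrm a * opnorm (a^-1 *: (a *: T)).
  by rewrite scalerA mulVf// scale1r.
rewrite (le_trans (ler_wpM2l (nrm_ge0 a) (opnormZ_le _ _)))// mulrA.
by rewrite -nrmM mulfV// nrm1 mul1r.
Qed.

Lemma opnorm0_eq0 T : of_real (opnorm T) = 0 :> K -> T = 0.
Proof.
move=> /(congr1 re_part); rewrite of_realK -(@of_real0 R s) of_realK => T0.
apply/val_inj/funext => x; apply: nrm0_eq0; apply/eqP; rewrite eq_le nrm_ge0.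
by rewrite andbT (le_trans (le_opnorm T x))// T0 mul0r.
Qed.

HB.instance Definition _ :=
  Lmodule_isNormed.Build K bop ler_opnormD opnormZ opnorm0_eq0.

Lemma nrm_bop T : nrm T = opnorm T.
Proof. exact: of_realK. Qed.

End bounded_operators.

Section pnorm.
Context {R : realType}.
Implicit Types p u v : R.

Definition pnorm p u v : R := (u `^ p + v `^ p) `^ p^-1.

Lemma pnorm_ge0 p u v : 0 <= pnorm p u v.
Proof. exact: powR_ge0. Qed.

Lemma le_pnorm p u v u' v' : 1 < p -> 0 <= u <= u' -> 0 <= v <= v' ->
  pnorm p u v <= pnorm p u' v'.
Proof.
move=> p1 /andP[u0 uu'] /andP[v0 vv'].
have p0 : 0 <= p by rewrite ltW// (lt_trans _ p1).
rewrite ge0_ler_powR ?invr_ge0 ?nnegrE ?addr_ge0 ?powR_ge0//.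
by rewrite lerD// ge0_ler_powR// nnegrE// (le_trans _ uu', le_trans _ vv').
Qed.

Lemma pnorm_powR p u v : 1 < p -> (pnorm p u v) `^ p = u `^ p + v `^ p.
Proof.
move=> p1; have p0 : 0 < p by rewrite (lt_trans _ p1).
by rewrite -powRrM mulVf ?gt_eqF// powRr1// addr_ge0// powR_ge0.
Qed.

Lemma pnorm_eq0 p u v : 1 < p -> pnorm p u v = 0 -> u = 0 /\ v = 0.
Proof.
move=> p1 E; have p0 : p != 0 by rewrite gt_eqF// (lt_trans _ p1).
have := pnorm_powR u v p1; rewrite E powR0// => /esym/eqP.
rewrite paddr_eq0 ?powR_ge0// !powR_eq0 p0 !andbT.
by move=> /andP[/eqP -> /eqP ->].
Qed.

Lemma pnormZ p c u v : 1 < p -> 0 <= c -> 0 <= u -> 0 <= v ->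
  pnorm p (c * u) (c * v) = c * pnorm p u v.
Proof.
move=> p1 c0 u0 v0; have p0 : 0 < p by rewrite (lt_trans _ p1).
rewrite /pnorm !powRM// -mulrDr powRM ?addr_ge0 ?powR_ge0//.
by rewrite -powRrM mulfV ?gt_eqF// powRr1.
Qed.

Lemma ler_pnormD p u1 v1 u2 v2 : 1 < p ->
  0 <= u1 -> 0 <= v1 -> 0 <= u2 -> 0 <= v2 ->
  pnorm p (u1 + u2) (v1 + v2) <= pnorm p u1 v1 + pnorm p u2 v2.
Proof.
move=> p1 u10 v10 u20 v20; have p0 : 0 < p by rewrite (lt_trans _ p1).
move AE : (pnorm p u1 v1) => A; move BE : (pnorm p u2 v2) => B.
have [A0|A0] := eqVneq A 0.
  by move: AE; rewrite A0 => /(pnorm_eq0 p1)[-> ->]; rewrite !add0r BE.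
have [B0|B0] := eqVneq B 0.
  by move: BE; rewrite B0 => /(pnorm_eq0 p1)[-> ->]; rewrite !addr0 AE.
have Agt0 : 0 < A by rewrite lt0r A0 -AE pnorm_ge0.
have Bgt0 : 0 < B by rewrite lt0r B0 -BE pnorm_ge0.
have ABgt0 : 0 < A + B := addr_gt0 Agt0 Bgt0.
have [Age0 Bge0 ABge0] := And3 (ltW Agt0) (ltW Bgt0) (ltW ABgt0).
have AB0 : A + B != 0 by rewrite gt_eqF.
have t01 : 0 <= A / (A + B) <= 1.
  by rewrite divr_ge0//= ler_pdivrMr// mul1r lerDl.
have conv (a b : R) : 0 <= a -> 0 <= b -> ((a + b) / (A + B)) `^ p <=
    A / (A + B) * (a / A) `^ p + B / (A + B) * (b / B) `^ p.
  move=> a0 b0; have /andP[t0 t1] := t01.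
  have aA : a / A \in (`[0, +oo[%classic : set R).
    by rewrite inE /= in_itv /= andbT divr_ge0.
  have bB : b / B \in (`[0, +oo[%classic : set R).
    by rewrite inE /= in_itv /= andbT divr_ge0.
  have : (A / (A + B) * (a / A) + (1 - A / (A + B)) * (b / B)) `^ p <=
      A / (A + B) * (a / A) `^ p + (1 - A / (A + B)) * (b / B) `^ p.
    exact: (@convex_powR R p (ltW p1) (Itv01 t0 t1) _ _ aA bB).
  have -> : 1 - A / (A + B) = B / (A + B).
    by rewrite -[X in X - _](mulfV AB0) -mulrBl addrC addKr.
  suff -> : A / (A + B) * (a / A) + B / (A + B) * (b / B) = (a + b) / (A + B).
    by [].
  by rewrite mulrDl; congr (_ + _); rewrite mulrC mulrA divfK.
have key : ((u1 + u2) / (A + B)) `^ p + ((v1 + v2) / (A + B)) `^ p <= 1.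
  rewrite (le_trans (lerD (conv _ _ u10 u20) (conv _ _ v10 v20)))//.
  rewrite addrACA -!mulrDr.
  have unit C a b : 0 < C -> 0 <= a -> 0 <= b -> C = pnorm p a b ->
      (a / C) `^ p + (b / C) `^ p = 1.
    move=> C0 a0 b0 CE; rewrite !powRM ?invr_ge0 ?(ltW C0)// -mulrDl.
    rewrite -pnorm_powR// -CE -powRM ?invr_ge0 ?(ltW C0)//.
    by rewrite mulfV ?gt_eqF// powR1.
  by rewrite (unit A)// (unit B)// !mulr1 -mulrDl mulfV.
have -> : pnorm p (u1 + u2) (v1 + v2) =
    (A + B) * pnorm p ((u1 + u2) / (A + B)) ((v1 + v2) / (A + B)).
  have u0 : 0 <= (u1 + u2) / (A + B) by apply: divr_ge0 => //; exact: addr_ge0.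
  have v0 : 0 <= (v1 + v2) / (A + B) by apply: divr_ge0 => //; exact: addr_ge0.
  by rewrite -(pnormZ p1 ABge0 u0 v0) ![(A + B) * _]mulrC !divfK.
rewrite ger_pMr//; have <- : 1 `^ p^-1 = 1 :> R by rewrite powR1.
apply: ge0_ler_powR key; first by rewrite invr_ge0 ltW.
  by rewrite nnegrE addr_ge0// powR_ge0.
by rewrite nnegrE ler01.
Qed.

End pnorm.

Section psum.
Context {R : realType} {s : scalar_kind}.
Local Notation K := (scalars R s).

(* The parameter p1 (that p > 1) is what makes psum_norm a norm. The alias psum
   prevents the library's max norm on X * Y from being used. *)
Definition psum (p : R) (p1 : 1 < p) (X Y : normedModType K) : Type :=
  (X * Y)%type.

Variables (p : R) (p1 : 1 < p) (X Y : normedModType K).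
Local Notation XY := (psum p1 X Y).

HB.instance Definition _ := GRing.Lmodule.copy XY (X * Y)%type.

Definition psum_norm (z : XY) : K := of_real (pnorm p (nrm z.1) (nrm z.2)).

Lemma psum_normD (z t : XY) : psum_norm (z + t) <= psum_norm z + psum_norm t.
Proof.
rewrite -of_realD ler_of_real.
have le1 : 0 <= nrm (z.1 + t.1) <= nrm z.1 + nrm t.1.
  by rewrite nrm_ge0 ler_nrmD.
have le2 : 0 <= nrm (z.2 + t.2) <= nrm z.2 + nrm t.2.
  by rewrite nrm_ge0 ler_nrmD.
exact: (le_trans (le_pnorm p1 le1 le2) (ler_pnormD p1 (nrm_ge0 _) (nrm_ge0 _)
  (nrm_ge0 _) (nrm_ge0 _))).
Qed.

Lemma psum_normZ (a : K) (z : XY) : psum_norm (a *: z) = `|a| * psum_norm z.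
Proof.
rewrite /psum_norm /= !nrmZ -(nrmE a) -of_realM.
by rewrite pnormZ ?nrm_ge0.
Qed.

Lemma psum_norm_eq0 (z : XY) : psum_norm z = 0 -> z = 0.
Proof.
move=> /(congr1 re_part); rewrite of_realK -(@of_real0 R s) of_realK.
case: z => x y /(pnorm_eq0 p1)[/= /nrm0_eq0 -> /nrm0_eq0 ->].
by [].
Qed.

HB.instance Definition _ :=
  Lmodule_isNormed.Build K XY psum_normD psum_normZ psum_norm_eq0.

Lemma nrm_psum (z : XY) : nrm z = (nrm z.1 `^ p + nrm z.2 `^ p) `^ p^-1.
Proof. exact: of_realK. Qed.

End psum.

Section M_ideals.
Context {R : realType} {s : scalar_kind}.
Local Notation K := (scalars R s).

Definition dual (E : normedModType K) : normedModType K := bop E K^o.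

Definition is_subspace (E : lmodType K) (Y : set E) :=
  Y 0 /\ forall (a : K) x y, Y x -> Y y -> Y (a *: x + y).

Definition annihilator (E : normedModType K) (Y : set E) : set (dual E) :=
  [set f | forall y, Y y -> f y = 0].

Definition direct_sum (E : lmodType K) (Z W : set E) :=
  [set z + w | z in Z & w in W] = setT /\ Z `&` W = [set 0].

Definition M_ideal (E : normedModType K) (Y : set E) :=
  [/\ closed Y, is_subspace Y &
    exists Z : set (dual E),
      [/\ is_subspace Z, direct_sum Z (annihilator Y) &
        forall z w, Z z -> annihilator Y w -> nrm (z + w) = nrm z + nrm w]].

Definition compact_ops (E F : normedModType K) : set (bop E F) :=
  [set T | compact (closure (T @` [set x | nrm x <= 1]))].

Definition property_Mp (p : R) (p1 : 1 < p) (X : normedModType K) :=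
  M_ideal (@compact_ops (psum p1 X X) (psum p1 X X)).

End M_ideals.

Definition separable (T : topologicalType) :=
  exists2 D : set T, countable D & dense D.

Definition exactly_one (A B C : Prop) :=
  [\/ [/\ A, ~ B & ~ C], [/\ ~ A, B & ~ C] | [/\ ~ A, ~ B & C]].

Section operators.
Context {R : realType} {s : scalar_kind}.
Local Notation K := (scalars R s).

Definition finite_dimensional (X : lmodType K) :=
  exists n (e : 'I_n -> X),
    forall x, exists c : 'I_n -> K, x = \sum_i c i *: e i.

Variable X : normedModType K.
Implicit Types T : bop X X.

Definition ess_norm T : R :=
  inf [set opnorm (T - C) | C in @compact_ops R s X X].

Definition norm_attaining T :=
  exists2 x : X, nrm x <= 1 & nrm (T x) = opnorm T.

Definition weak : topologicalType := sup_topology (fun f : dual X =>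
  Topological.class (initial_topology (f : X -> K^o))).

Definition MS T : set (nat -> X) :=
  [set x | (forall n, nrm (x n) = 1) /\ (nrm (T (x n)) @[n --> \oo] --> opnorm T)].

Definition WC T : set X :=
  \bigcup_(x in MS T)
    \bigcap_k closure (x @` [set n | (k <= n)%N] : set weak).

(* Extended-real valued, so that the empty set would have infimum +oo and
   supremum -oo (the real-valued inf and sup are 0 on the empty set). *)
Definition m_min T : \bar R := ereal_inf [set (nrm x)%:E | x in WC T].
Definition m_max T : \bar R := ereal_sup [set (nrm x)%:E | x in WC T].

End operators.

(* Main.v *)
Require Import Defs.
From HB Require Import structures.
From mathcomp Require Import all_boot all_order all_algebra.
From mathcomp Require Import all_classical all_reals all_analysis.
From mathcomp Require Import complex ring lra.

Set Implicit Arguments.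
Unset Strict Implicit.
Unset Printing Implicit Defensive.

Import Order.TTheory GRing.Theory Num.Theory.
Import numFieldNormedType.Exports.

Local Open Scope classical_set_scope.
Local Open Scope ring_scope.

(** Let [Z] be the sum of two copies of [X] with the norm [|(x, y)|^p =
    |x|^p + |y|^p]. The M-ideal hypothesis is used in one form only
    ([compact_approximation]): for a compact operator [S] on [Z] of norm at
    most 1 there are compact operators [C] such that [1 + S - C] is nearly
    contractive, [C] nearly fixes a given vector, and the adjoint of [C]
    nearly fixes finitely many given functionals. This is a Hahn--Banach
    separation ([M_ideal_ball]), which works because the functionals [t |->
    f (t v)] on operators, and those that depend only on [f \o t], lie in
    the L-summand complementary to the annihilator of the compact operators
    ([tame_eval], [tame_comp]).

    A rank-one [S] that moves a vector of one copy of [X] to the other copy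
    turns this into a formula for norms. Let [h] be a bounded family in [X],
    indexed by a set with an ultrafilter, and let [D a] be the limit of [|h
    t - a|]. If [S] sends [(x, y)] to [(g y *: u, 0)] with [u] a unit
    vector, one obtains [|lim g (h t) - g a|^p + (inf D)^p <= (D a)^p] for
    every functional [g] of norm at most 1 ([dist_lower]). So sequences
    minimizing [D] are Cauchy, and their limit [x] is the weak limit of the
    family: bounded sets are relatively weakly compact, and [|x - a|^p + (D
    x)^p <= (D a)^p] ([weak_limit]). If [S] moves [x - a] from the first
    copy to the second one, the opposite inequality results ([dist_upper]).

    Apply this to a maximizing family [h] of [T] with weak limit [x], and to
    its image under [T]. All terms of the chain [|T|^p <= |T x|^p + lim |T
    (h t) - T x|^p <= |T|^p (|x|^p + lim |h t - x|^p) <= |T|^p] are equal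
    ([maximizing_weak_limit]). Consequently [|T x| = |T| |x|], so that [T]
    attains its norm as soon as some weak cluster point is nonzero;
    conversely a unit vector at which [T] attains its norm is a cluster
    point of a constant sequence. Moreover, if [|x| < 1] then [h t - x] is
    weakly null, does not tend to 0, and satisfies [lim |T (h t - x)| = |T|
    lim |h t - x|]. Compact operators tend to 0 along it, whence [|T|] is
    the essential norm ([WC_ess_norm]).

    Conversely, suppose that [|T|] is the essential norm and [T] is nonzero.
    For compact [C] as above, with [S = 0], one has [|T - T C| >= |T|], and vectors [x - C x]
    at which [|T (x - C x)|] is almost [|T|] are almost unit vectors and
    small at the given functionals. Letting these exhaust a separating
    sequence of functionals, which exists because [X] is separable, one
    finds 0 among the weak cluster points ([ess_norm_zero_WC]). For [T = 0]
    on an infinite-dimensional space, unit vectors in the kernels of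
    finitely many functionals do the same. *)

(** * Scalars and the Hahn--Banach theorem *)

Section scalar_parts.
Context {R : realType} {s : scalar_kind}.
Local Notation K := (scalars R s).
Implicit Types (x y : K) (a : R).

Lemma of_real_id x : 0 <= x -> of_real (nrm x) = x.
Proof. by move=> x0; rewrite nrmE ger0_norm. Qed.

Lemma of_real1 : of_real 1 = 1 :> K.
Proof. by rewrite -(normr1 K) -nrmE nrm1. Qed.

Lemma of_realN a : of_real (- a) = - of_real a :> K.
Proof. by apply/eqP; rewrite -addr_eq0 -of_realD addNr of_real0. Qed.

Lemma re_partD x y : re_part (x + y) = re_part x + re_part y.
Proof. by rewrite /re_part; case: s x y => //= -[a b] [c d]. Qed.

Lemma re_partZ a x : re_part (of_real a * x) = a * re_part x.
Proof.
by rewrite /re_part /of_real; case: s x => //= -[b c] /=; rewrite mul0r subr0.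
Qed.

Lemma re_part0 : re_part (0 : K) = 0.
Proof. by rewrite -of_real0 of_realK. Qed.

Lemma re_partN x : re_part (- x) = - re_part x.
Proof. by apply/eqP; rewrite -addr_eq0 -re_partD addNr re_part0. Qed.

Lemma nrmN (V : normedZmodType K) (v : V) : nrm (- v) = nrm v.
Proof. by rewrite /nrm normrN. Qed.

Lemma re_part_le_nrm x : re_part x <= nrm x.
Proof.
rewrite /nrm /re_part; case: s x => /= [x|x]; first exact: ler_norm.
by have := normc_ge_Re x; rewrite lecR; apply: le_trans; exact: ler_norm.
Qed.

Lemma rotate_scalar x : exists2 c : K, nrm c <= 1 & c * x = of_real (nrm x).
Proof.
have [->|x0] := eqVneq x 0.
  by exists 0; rewrite ?nrm0 ?mul0r ?of_real0.
exists (of_real (nrm x) / x); last by rewrite divfK.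
have nx0 : nrm x != 0 by apply: contra_neq x0 => /nrm0_eq0.
rewrite -(ler_of_real (s := s)) nrmE normrM normfV -!nrmE nrm_of_real.
rewrite ger0_norm ?nrm_ge0// mulfV ?of_real1//.
by rewrite -(of_real0 (s := s)) (inj_eq (can_inj of_realK)).
Qed.

End scalar_parts.

Section hahn_banach.
Context {R : realType} {s : scalar_kind}.
Local Notation K := (scalars R s).
Variable V : lmodType K.

Definition seminorm (q : V -> R) :=
  (forall x y, q (x + y) <= q x + q y) /\
  (forall c x, q (c *: x) = nrm c * q x).

(** A real-linear functional on a real subspace is represented by its graph:
    the domain need not be named, and chains of extensions have unions for
    suprema. That the graph is one of a function follows from domination. *)
Definition real_linear_graph (G : set (V * R)) :=
  forall (c : R) u v, G u -> G v -> G (of_real c *: u.1 + v.1, c * u.2 + v.2).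

Definition dominated (q : V -> R) (G : set (V * R)) :=
  forall u, G u -> u.2 <= q u.1.

Variable q : V -> R.
Hypothesis qseminorm : seminorm q.

Let qD x y : q (x + y) <= q x + q y. Proof. exact: qseminorm.1. Qed.
Let qZ c x : q (c *: x) = nrm c * q x. Proof. exact: qseminorm.2. Qed.
Let q0 : q 0 = 0. Proof. by rewrite -(scale0r 0) qZ nrm0 mul0r. Qed.

Lemma dominated_functional G x r t : real_linear_graph G -> dominated q G ->
  G (x, r) -> G (x, t) -> r = t.
Proof.
move=> Glin Gq Gr Gt.
have aux r' t' : G (x, r') -> G (x, t') -> r' <= t'.
  move=> Gr' Gt'; have := Gq _ (Glin (-1) _ _ Gt' Gr').
  by rewrite /= of_realN of_real1 scaleN1r addNr q0 mulN1r addrC subr_le0.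
by apply/eqP; rewrite eq_le !aux.
Qed.

(** The admissible values at a new vector [x] form a nonempty interval, since
    [r + t <= q (u + v) <= q (u - x) + q (v + x)] on the graph. *)
Lemma dominated_extension G x : G !=set0 -> real_linear_graph G ->
  dominated q G -> exists H, [/\ G `<=` H, real_linear_graph H, dominated q H &
    exists r, H (x, r)].
Proof.
move=> [g0 Gg0] Glin Gq.
pose A := [set u.2 - q (u.1 - x) | u in G].
have ub v : G v -> ubound A (q (v.1 + x) - v.2).
  move=> Gv _ [u Gu <-]; rewrite lerBlDr addrAC lerBrDr.
  have := Gq _ (Glin 1 _ _ Gu Gv); rewrite /= of_real1 scale1r mul1r.
  move=> /le_trans; apply.
  have -> : u.1 + v.1 = (v.1 + x) + (u.1 - x).
    by rewrite [u.1 - x]addrC addrA addrK addrC.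
  exact: qD.
have A0 : A !=set0 by exists (g0.2 - q (g0.1 - x)), g0.
have supA : has_sup A by split => //; exists (q (g0.1 + x) - g0.2); exact: ub.
pose r := sup A.
have rle v : G v -> v.2 + r <= q (v.1 + x).
  by move=> Gv; rewrite addrC -lerBrDr; apply: ge_sup => //; exact: ub.
have ler v : G v -> v.2 - r <= q (v.1 - x).
  move=> Gv; rewrite lerBlDr addrC -lerBlDr; apply: (sup_upper_bound supA).
  by exists v.
have Gzero : G (0, 0).
  have := Glin (-1) _ _ Gg0 Gg0.
  by rewrite of_realN of_real1 scaleN1r mulN1r !addNr.
have Gscale c v : G v -> G (of_real c *: v.1, c * v.2).
  by move=> Gv; have := Glin c _ _ Gv Gzero; rewrite /= !addr0.
exists [set w | exists c v, G v /\ w = (v.1 + of_real c *: x, v.2 + c * r)].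
split.
- move=> v Gv; exists 0, v.
  by rewrite of_real0 scale0r mul0r !addr0; case: v Gv.
- move=> a _ _ [c [u [Gu ->]]] [d [v [Gv ->]]].
  exists (a * c + d), (of_real a *: u.1 + v.1, a * u.2 + v.2); split.
    exact: Glin.
  rewrite /= !scalerDr scalerA -of_realM addrACA -scalerDl -of_realD.
  by rewrite !mulrDr addrACA mulrA -mulrDl.
- move=> _ [c [v [Gv ->]]] /=.
  have [c0|c0|->] := ltgtP c 0; last first.
  + by rewrite of_real0 scale0r mul0r !addr0; exact: Gq.
  + have := rle _ (Gscale c^-1 _ Gv); rewrite /= -(ler_pM2l c0) => h.
    have -> : v.1 + of_real c *: x = of_real c *: (of_real c^-1 *: v.1 + x).
      by rewrite scalerDr scalerA -of_realM mulfV ?gt_eqF// of_real1 scale1r.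
    rewrite qZ nrm_of_real gtr0_norm// (le_trans _ h)//.
    by rewrite mulrDr mulrA mulfV ?gt_eqF// mul1r.
  + have d0 : 0 < - c by rewrite oppr_gt0.
    have := ler _ (Gscale (- c)^-1 _ Gv); rewrite /= -(ler_pM2l d0) => h.
    have -> : v.1 + of_real c *: x =
        of_real (- c) *: (of_real (- c)^-1 *: v.1 - x).
      rewrite scalerDr scalerA -of_realM mulfV ?gt_eqF// of_real1 scale1r.
      by rewrite of_realN scalerN scaleNr opprK.
    rewrite qZ nrm_of_real gtr0_norm// (le_trans _ h)//.
    by rewrite mulrDr mulrA mulfV ?gt_eqF// mul1r mulrNN.
- by exists r, 1, (0, 0); rewrite of_real1 scale1r mul1r !add0r.
Qed.

(** A maximal dominated real-linear graph above [G] is defined everywhere,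
    by the one-dimensional extension above. *)
Lemma real_hahn_banach G : G !=set0 -> real_linear_graph G -> dominated q G ->
  exists f : V -> R, [/\ forall u, G u -> f u.1 = u.2,
    forall (c : R) x y, f (of_real c *: x + y) = c * f x + f y &
    forall x, f x <= q x].
Proof.
move=> G0 Glin Gq.
(* The union of the empty chain is [set0], which does not contain [G]; hence
   the property is required of the union with [G]. *)
pose P H := real_linear_graph (G `|` H) /\ dominated q (G `|` H).
have P0 : P set0 by rewrite /P setU0.
have [F FP Ftot|H [[Hlin Hq] Hmax]] := @Zorn_bigcup _ P.
  split=> [c u v Fu Fv|u [/Gq//|[X FX Xu]]]; last by apply: (FP _ FX).2; right.
  suff [X [PX XF Xu Xv]] : exists X, [/\ P X, (X `<=` \bigcup_(Y in F) Y),
      (G `|` X) u & (G `|` X) v].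
    by apply: setUS XF _ _; exact: PX.1.
  case: Fu Fv => [Gu|[X FX Xu]] [Gv|[Y FY Yv]].
  - by exists set0; split=> //; left.
  - by exists Y; split; [exact: FP|exact: bigcup_sup|left|right].
  - by exists X; split; [exact: FP|exact: bigcup_sup|right|left].
  - have [XY|YX] := Ftot _ _ FX FY.
      by exists Y; split; [exact: FP|exact: bigcup_sup|right; exact: XY|right].
    by exists X; split; [exact: FP|exact: bigcup_sup|right|right; exact: YX].
have Htotal x : exists r, (G `|` H) (x, r).
  have GH0 : G `|` H !=set0 by case: G0 => u Gu; exists u; left.
  have [H' [GHH' H'lin H'q [r H'xr]]] := dominated_extension x GH0 Hlin Hq.
  exists r; right; apply: contrapT => nHxr.
  apply: (Hmax H'); last first.
    rewrite /P (_ : G `|` H' = H')//; apply/setUidPr => u Gu.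
    by apply: GHH'; left.
  split=> [|/(_ _ H'xr)//]; by apply: subset_trans GHH'; exact: subsetUr.
have [f fH] := choice Htotal.
have fE u : (G `|` H) u -> f u.1 = u.2.
  by case: u => x r Gu; exact: (dominated_functional Hlin Hq (fH x) Gu).
exists f; split=> [u Gu|c x y|x]; first by apply: fE; left.
- exact: (fE _ (Hlin c _ _ (fH x) (fH y))).
- exact: (Hq _ (fH x)).
Qed.

End hahn_banach.

Section complexification.
Context {R : realType} {s : scalar_kind}.
Local Notation K := (scalars R s).
Variable V : lmodType K.

(** Over the complex numbers the functional is [f x - i f (i x)]. *)
Lemma linear_of_re_part (f : V -> R) :
  (forall (c : R) x y, f (of_real c *: x + y) = c * f x + f y) ->
  exists2 g : V -> K, (forall c x y, g (c *: x + y) = c * g x + g y) &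
    forall x, re_part (g x) = f x.
Proof.
rewrite /of_real /re_part; move: V f; case: s => /= W f flin.
  by exists f.
have fD x y : f (x + y) = f x + f y.
  by have := flin 1 x y; rewrite rmorph1 scale1r mul1r.
have f0 : f 0 = 0 by apply: (addrI (f 0)); rewrite -fD !addr0.
have fZ (c : R) x : f (c%:C%C *: x) = c * f x.
  by have := flin c x 0; rewrite f0 !addr0.
pose i : R[i] := 'i%C.
exists (fun x => (f x)%:C%C - i * (f (i *: x))%:C%C); last first.
  by move=> x /=; rewrite !mul0r !mul1r subr0 oppr0 addr0.
have fiZ (a b : R) x : f ((a +i* b)%C *: x) = a * f x + b * f (i *: x).
  have -> : (a +i* b)%C = a%:C%C + b%:C%C * i.
    apply/eqP; rewrite eq_complex /=.
    by rewrite !(mulr0, mulr1, mul0r, subr0, addr0, add0r) !eqxx.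
  by rewrite scalerDl fD fZ -scalerA fZ.
move=> [a b] x y; rewrite scalerDr scalerA !fD (fiZ a b).
have -> : i * (a +i* b)%C = ((- b) +i* a)%C.
  by apply/eqP; rewrite eq_complex /= !mul0r !mul1r sub0r add0r !eqxx.
rewrite (fiZ (- b) a); apply/eqP; rewrite eq_complex /=.
by apply/andP; split; apply/eqP; ring.
Qed.

Lemma functional0 (g : V -> K) :
  (forall c x y, g (c *: x + y) = c * g x + g y) -> g 0 = 0.
Proof.
move=> glin; apply: (addrI (g 0)).
by have := glin 1 0 0; rewrite scale1r addr0 mul1r => <-; rewrite addr0.
Qed.

Lemma functionalZ (g : V -> K) c x :
  (forall c x y, g (c *: x + y) = c * g x + g y) -> g (c *: x) = c * g x.
Proof. by move=> glin; rewrite -[c *: x]addr0 glin functional0// addr0. Qed.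

Lemma seminorm_ge0 (q : V -> R) x : seminorm q -> 0 <= q x.
Proof.
move=> [qD qZ]; have := qD x (- x).
by rewrite subrr -(scale0r 0) qZ nrm0 mul0r -scaleN1r qZ nrmN nrm1; lra.
Qed.

(** Rotating [x] makes the value at it real and nonnegative. *)
Lemma linear_le_seminorm (q : V -> R) (g : V -> K) : seminorm q ->
  (forall c x y, g (c *: x + y) = c * g x + g y) ->
  (forall x, re_part (g x) <= q x) -> forall x, nrm (g x) <= q x.
Proof.
move=> qsemi glin gq x; have [c c1 cgx] := rotate_scalar (g x).
rewrite -[leLHS](of_realK (s := s)) -cgx -functionalZ//.
by rewrite (le_trans (gq _))// qsemi.2 ler_piMl// seminorm_ge0.
Qed.

Lemma linear_re_part0 (g : V -> K) (W : set V) :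
  (forall c x y, g (c *: x + y) = c * g x + g y) ->
  (forall c x, W x -> W (c *: x)) ->
  (forall x, W x -> re_part (g x) = 0) -> forall x, W x -> g x = 0.
Proof.
move=> glin WZ gW x Wx; have [c _ cgx] := rotate_scalar (g x).
by have := gW _ (WZ c _ Wx); rewrite functionalZ// cgx of_realK => /nrm0_eq0.
Qed.

(** Prescribing only the real parts, on a real subspace, covers two uses at
    once: extension of functionals, and separation of a point from a
    subspace. *)
Theorem hahn_banach (q : V -> R) (G : set (V * R)) : seminorm q ->
  G !=set0 -> real_linear_graph G -> dominated q G ->
  exists g : V -> K, [/\ (forall c x y, g (c *: x + y) = c * g x + g y),
    forall u, G u -> re_part (g u.1) = u.2 & forall x, nrm (g x) <= q x].
Proof.
move=> qsemi G0 Glin Gq.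
have [f [fG flin fq]] := real_hahn_banach qsemi G0 Glin Gq.
have [g glin gf] := linear_of_re_part flin.
exists g; split=> // [u Gu|]; first by rewrite gf fG.
by apply: linear_le_seminorm => // x; rewrite gf.
Qed.

End complexification.

(** * Bounded operators and functionals *)

Section operators.
Context {R : realType} {s : scalar_kind}.
Local Notation K := (scalars R s).
Implicit Types V W Y : normedModType K.

Lemma bopDE V W (T S : bop V W) x : (T + S) x = T x + S x.
Proof. by []. Qed.

Lemma bopBE V W (T S : bop V W) x : (T - S) x = T x - S x.
Proof. by []. Qed.

Lemma bopZE V W (c : K) (T : bop V W) x : (c *: T) x = c *: T x.
Proof. by []. Qed.

Lemma bop0r V W (T : bop V W) : T 0 = 0.
Proof. exact: linear0. Qed.

Lemma bopDr V W (T : bop V W) x y : T (x + y) = T x + T y.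
Proof. exact: linearD. Qed.

Lemma bopBr V W (T : bop V W) x y : T (x - y) = T x - T y.
Proof. exact: linearB. Qed.

Lemma bopZr V W (T : bop V W) c x : T (c *: x) = c *: T x.
Proof. exact: linearZ. Qed.

Lemma dualDE V (f g : dual V) x : (f + g) x = f x + g x.
Proof. by []. Qed.

Lemma bop_ext V W (T S : bop V W) : (forall x, T x = S x) -> T = S.
Proof. by move=> TS; apply/val_inj/funext. Qed.

Lemma opnorm_leM V W (T : bop V W) (M : R) : 0 <= M ->
  (forall x, nrm (T x) <= M * nrm x) -> opnorm T <= M.
Proof.
move=> M0 TM; apply: opnorm_le => x x1.
by rewrite (le_trans (TM x))// ler_piMr.
Qed.

Lemma bounded_linearP V W (f : V -> W) : linear f ->
  (exists M : R, forall x, nrm (f x) <= M * nrm x) ->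
  f \in bounded_linear (X := V) (Y := W).
Proof. by move=> flin fM; rewrite inE. Qed.

Lemma functional_bop V (g : V -> K) (M : R) :
  (forall c x y, g (c *: x + y) = c * g x + g y) ->
  (forall x, nrm (g x) <= M * nrm x) ->
  exists f : dual V, forall x, f x = g x.
Proof.
move=> glin gM.
have gP : (g : V -> K^o) \in bounded_linear (X := V) (Y := K^o).
  by apply: bounded_linearP => //; exists M.
by exists (Bop gP).
Qed.

Definition bcomp V W Y (S : bop W Y) (T : bop V W) : bop V Y.
Proof.
refine (@Bop _ _ _ _ (fun x => S (T x)) _).
apply: bounded_linearP => [c x y|]; first by rewrite !linearP.
exists (opnorm S * opnorm T) => x.
rewrite (le_trans (le_opnorm S (T x)))// -mulrA.
by rewrite ler_wpM2l ?opnorm_ge0 ?le_opnorm.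
Defined.

Lemma bcompE V W Y (S : bop W Y) (T : bop V W) x : bcomp S T x = S (T x).
Proof. by []. Qed.

Definition rank_one V W (h : dual V) (w : W) : bop V W.
Proof.
refine (@Bop _ _ _ _ (fun x => (h x : K) *: w) _).
apply: bounded_linearP => [c x y|].
  by rewrite linearP /= scalerDl scalerA.
exists (opnorm h * nrm w) => x; rewrite nrmZ mulrAC.
by rewrite ler_wpM2r ?nrm_ge0 ?(le_opnorm h).
Defined.

Lemma rank_oneE V W (h : dual V) (w : W) x : rank_one h w x = (h x : K) *: w.
Proof. by []. Qed.

Lemma opnorm_rank_one V W (h : dual V) (w : W) :
  opnorm (rank_one h w) <= opnorm h * nrm w.
Proof.
apply: opnorm_leM => [|x]; first by rewrite mulr_ge0 ?opnorm_ge0 ?nrm_ge0.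
by rewrite rank_oneE nrmZ mulrAC ler_wpM2r ?nrm_ge0 ?(le_opnorm h).
Qed.

Lemma norming_functional V (x : V) :
  exists2 f : dual V, opnorm f <= 1 & f x = of_real (nrm x) :> K.
Proof.
have qsemi : seminorm (nrm (V := V)).
  by split=> *; [exact: ler_nrmD|exact: nrmZ].
pose G : set (V * R) := [set (of_real c *: x, c * nrm x) | c in setT].
have G0 : G !=set0 by exists (of_real 0 *: x, 0 * nrm x), 0.
have [||g [glin gG gle]] := hahn_banach qsemi G0.
- move=> c _ _ [a _ <-] [b _ <-]; exists (c * a + b) => //=.
  by rewrite of_realD of_realM scalerDl scalerA mulrDl mulrA.
- move=> _ [c _ <-] /=; rewrite nrmZ nrm_of_real.
  by rewrite ler_wpM2r ?nrm_ge0 ?ler_norm.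
have [f fg] : exists f : dual V, forall x, f x = g x.
  by apply: (functional_bop (M := 1)) => // y; rewrite mul1r.
have re_gx : re_part (g x) = nrm x.
  by apply: (gG (x, nrm x)); exists 1; rewrite ?of_real1 ?scale1r ?mul1r.
have gx : nrm (g x) = nrm x.
  by apply/eqP; rewrite eq_le gle /= -{1}re_gx re_part_le_nrm.
have [c c1 cgx] := rotate_scalar (g x).
exists (c *: f); last by rewrite bopZE fg -gx -cgx.
apply: opnorm_leM => // y; rewrite mul1r bopZE nrmZ fg.
by rewrite (le_trans _ (gle y))// ler_piMl ?nrm_ge0.
Qed.

Lemma nrm_le_functionals V (x : V) (M : R) :
  (forall f : dual V, opnorm f <= 1 -> nrm (f x) <= M) -> nrm x <= M.
Proof.
move=> xM; have [f f1 fx] := norming_functional x.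
by have := xM f f1; rewrite fx nrm_of_real ger0_norm ?nrm_ge0.
Qed.

End operators.

(** * The ball property of M-ideals *)

Section M_ideal_ball.
Context {R : realType} {s : scalar_kind}.
Local Notation K := (scalars R s).
Variables (E : normedModType K) (J : set E) (Z : set (dual E)).
Hypothesis Jsub : is_subspace J.
Hypothesis Zsub : is_subspace Z.
Hypothesis ZJ : direct_sum Z (annihilator J).
Hypothesis L_sum :
  forall z w, Z z -> annihilator J w -> nrm (z + w) = nrm z + nrm w.

Let JZ c k : J k -> J (c *: k).
Proof. by move=> Jk; have := Jsub.2 c k 0 Jk Jsub.1; rewrite addr0. Qed.

Let ZD f g : Z f -> Z g -> Z (f + g).
Proof. by move=> Zf Zg; have := Zsub.2 1 f g Zf Zg; rewrite scale1r. Qed.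

Let decomp (f : dual E) : exists z w, [/\ Z z, annihilator J w & f = z + w].
Proof.
have : [set z + w | z in Z & w in annihilator J] f by rewrite ZJ.1.
by move=> [z Zz [w Jw zw]]; exists z, w.
Qed.

(** If the values of [f] are already taken on [J], at arguments of almost
    the same norm, then in [f = z + w] the part [z] has the norm of [f], and
    the L-sum formula forces [w = 0]. *)
Lemma L_summandP (f : dual E) : (forall t e, 0 < e ->
    exists k, [/\ J k, f (t - k) = 0 & nrm k <= (1 + e) * nrm t]) -> Z f.
Proof.
move=> flift; have [z [w [Zz Jw fzw]]] := decomp f.
suff w0 : w = 0 by rewrite fzw w0 addr0.
apply: nrm0_eq0; apply/eqP; rewrite eq_le nrm_ge0 andbT.
rewrite -(lerD2l (nrm z)) addr0 -L_sum// -fzw.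
rewrite nrm_bop; apply: opnorm_leM => [|t]; first exact: nrm_ge0.
apply/ler_addgt0Pl => e e0.
pose d := e / (nrm z * nrm t + 1).
have M0 : 0 < nrm z * nrm t + 1 by rewrite ltr_wpDl ?mulr_ge0 ?nrm_ge0.
have d0 : 0 < d by rewrite divr_gt0.
have [k [Jk ftk nk]] := flift t d d0.
have -> : f t = z k.
  apply/eqP; move/eqP: ftk; rewrite bopBr subr_eq0 => /eqP ->.
  by rewrite fzw dualDE (Jw k Jk) addr0.
rewrite (le_trans (le_opnorm z k))// -nrm_bop.
rewrite (le_trans (ler_wpM2l (nrm_ge0 z) nk))//.
rewrite mulrCA mulrDl mul1r addrC lerD2r.
by rewrite /d mulrAC ler_pdivrMr// ler_pM2l// lerDl.
Qed.

(** A seminorm is tame if it controls only functionals of the L-summand [Z].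
    Such seminorms can be added as side conditions to the ball property. *)
Definition tame (nu : E -> R) :=
  [/\ seminorm nu, exists M : R, forall t, nu t <= M * nrm t &
    forall f : dual E, (forall t, nrm (f t) <= nu t) -> Z f].

Lemma tame_lift nu : seminorm nu ->
  (exists M : R, forall t, nu t <= M * nrm t) ->
  (forall t e, 0 < e ->
    exists k, [/\ J k, nu (t - k) = 0 & nrm k <= (1 + e) * nrm t]) ->
  tame nu.
Proof.
move=> nusemi nuM nulift; split=> // f fnu; apply: L_summandP => t e e0.
have [k [Jk nutk nk]] := nulift t e e0.
exists k; split=> //; apply: nrm0_eq0; apply/eqP.
by rewrite eq_le nrm_ge0 -{1}nutk fnu.
Qed.

Let seminorm_pair nu1 nu2 : seminorm nu1 -> seminorm nu2 ->
  seminorm (fun u : E * E => nu1 u.1 + nu2 u.2).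
Proof.
move=> [D1 Z1] [D2 Z2]; split=> [x y|c x] /=; last by rewrite Z1 Z2 mulrDr.
by rewrite addrACA lerD.
Qed.

Let seminorm0 nu : seminorm nu -> nu (0 : E) = 0.
Proof. by move=> [_ nuZ]; rewrite -(scale0r 0) nuZ nrm0 mul0r. Qed.

Let components nu1 nu2 (M1 M2 : R) (g : E * E -> K) :
  seminorm nu1 -> seminorm nu2 ->
  (forall t, nu1 t <= M1 * nrm t) -> (forall t, nu2 t <= M2 * nrm t) ->
  (forall c x y, g (c *: x + y) = c * g x + g y) ->
  (forall u, nrm (g u) <= nu1 u.1 + nu2 u.2) ->
  exists f1 f2 : dual E, [/\ forall t, nrm (f1 t) <= nu1 t,
    forall t, nrm (f2 t) <= nu2 t & forall u, g u = f1 u.1 + f2 u.2].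
Proof.
move=> semi1 semi2 nuM1 nuM2 glin gle.
have le1 t : nrm (g (t, 0)) <= nu1 t.
  by rewrite (le_trans (gle _))//= seminorm0// addr0.
have le2 t : nrm (g (0, t)) <= nu2 t.
  by rewrite (le_trans (gle _))//= seminorm0// add0r.
have [f1 f1E] : exists f : dual E, forall t, f t = g (t, 0).
  apply: (functional_bop (M := M1)) => [c x y|t]; last exact: le_trans (nuM1 t).
  by rewrite -glin; congr g; congr pair; rewrite /= scaler0 addr0.
have [f2 f2E] : exists f : dual E, forall t, f t = g (0, t).
  apply: (functional_bop (M := M2)) => [c x y|t]; last exact: le_trans (nuM2 t).
  by rewrite -glin; congr g; congr pair; rewrite /= scaler0 addr0.
exists f1, f2; split=> [t|t|[t1 t2]]; rewrite ?f1E ?f2E//=.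
rewrite -[g (t1, 0)]mul1r -glin; congr g.
by rewrite scale1r; congr pair; rewrite /= ?addr0 ?add0r.
Qed.

(** A functional dominated by [nu1 + nu2] splits into two functionals dominated
    by [nu1] and [nu2]: extend it from the diagonal of [E * E]. *)
Lemma tameD nu1 nu2 : tame nu1 -> tame nu2 -> tame (fun t => nu1 t + nu2 t).
Proof.
move=> [semi1 [M1 nuM1] Z1] [semi2 [M2 nuM2] Z2]; split.
- split=> [x y|c x]; last by rewrite semi1.2 semi2.2 mulrDr.
  by rewrite addrACA lerD// (semi1.1, semi2.1).
- by exists (M1 + M2) => t; rewrite mulrDl lerD.
move=> f fle.
pose G : set (E * E * R) := [set ((t, t), re_part (f t : K)) | t in setT].
have G0 : G !=set0 by exists ((0, 0), re_part (f 0 : K)), 0.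
have [||g [glin gG gle]] := hahn_banach (seminorm_pair semi1 semi2) G0.
- move=> c _ _ [t _ <-] [u _ <-]; exists (of_real c *: t + u) => //=.
  by rewrite linearP /= re_partD re_partZ.
- by move=> _ [t _ <-] /=; rewrite (le_trans (re_part_le_nrm _))// fle.
have [f1 [f2 [f1le f2le gE]]] := components semi1 semi2 nuM1 nuM2 glin gle.
suff -> : f = f1 + f2 by apply: ZD; [exact: Z1|exact: Z2].
apply/eqP; rewrite -subr_eq0; apply/eqP; apply: bop_ext => t.
pose h : dual E := f - (f1 + f2).
apply: (@linear_re_part0 _ _ E (h : E -> K) setT) => //.
  by move=> c x y; rewrite linearP.
move=> x _; rewrite -[h x]/(f x - (f1 x + f2 x)) re_partD re_partN -(gE (x, x)).
have -> : re_part (g (x, x)) = re_part (f x : K).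
  by apply: (gG ((x, x), _)); exists x.
by rewrite subrr.
Qed.

(** If no such [k] exists, a functional on [E * E] separates the subspace
    [{(k, k) | k in J}] from [(x + y, x)]. On [J] its first component [z +
    w] is minus the second one, which lies in [Z], so that the second
    component cancels [z]. The value at [(x + y, x)] is then [w x + z y], of
    modulus at most [nrm z + nrm w], which is the norm of the first
    component. *)
Lemma M_ideal_ball nu x y e : tame nu -> J y -> nrm y <= 1 -> nrm x <= 1 ->
  0 < e -> exists2 k, J k & nrm (x + y - k) + nu (x - k) < 1 + e.
Proof.
move=> [nusemi [M nuM] nuZ] Jy y1 x1 e0; apply: contrapT => nk.
have kge k : J k -> 1 + e <= nrm (x + y - k) + nu (x - k).
  by move=> Jk; rewrite leNgt; apply/negP => lt; apply: nk; exists k.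
have nsemi : seminorm (nrm (V := E)).
  by split=> *; [exact: ler_nrmD|exact: nrmZ].
have nM t : nrm t <= 1 * nrm (t : E) by rewrite mul1r.
pose G : set (E * E * R) := [set v | exists c k, J k /\
  v = ((k + of_real c *: (x + y), k + of_real c *: x), c * (1 + e))].
have G0 : G !=set0.
  by exists ((0 + of_real 0 *: (x + y), 0 + of_real 0 *: x), 0 * (1 + e)), 0, 0;
    split=> //; exact: Jsub.1.
have [||g [glin gG gle]] := hahn_banach (seminorm_pair nsemi nusemi) G0.
- move=> c _ _ [a [k [Jk ->]]] [b [l [Jl ->]]].
  exists (c * a + b), (of_real c *: k + l); split; first exact: Jsub.2.
  have aux v : of_real c *: (k + of_real a *: v) + (l + of_real b *: v) =
      of_real c *: k + l + of_real (c * a + b) *: v.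
    by rewrite of_realD of_realM scalerDl scalerDr scalerA addrACA.
  by rewrite /= -!aux mulrDl mulrA.
- move=> _ [c [k [Jk ->]]] /=.
  have [c0|c0] := leP c 0.
    rewrite (@le_trans _ _ 0)//; first by rewrite mulr_le0_ge0// addr_ge0 ?ltW.
    by rewrite addr_ge0// ?nrm_ge0// seminorm_ge0.
  have aux v : k + of_real c *: v = of_real c *: (v - of_real (- c^-1) *: k).
    rewrite scalerBr scalerA -of_realM mulrN mulfV ?gt_eqF//.
    by rewrite of_realN of_real1 scaleN1r opprK addrC.
  rewrite !aux nrmZ nusemi.2 nrm_of_real gtr0_norm// -mulrDr ler_pM2l//.
  by apply: kge; exact: JZ.
have [f1 [f2 [f1le f2le gE]]] := components nsemi nusemi nM nuM glin gle.
have gJ k : J k -> f1 k + f2 k = 0.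
  apply: (@linear_re_part0 _ _ E (fun t => f1 t + f2 t) J) => //.
    by move=> c u v; rewrite !linearP /= addrACA -scalerDr.
  move=> l Jl; rewrite -(gE (l, l)); apply: (gG ((l, l), 0)).
  by exists 0, l; rewrite of_real0 !scale0r addr0 mul0r.
have [z [w [Zz Jw f1E]]] := decomp f1.
have zf2 : z + f2 = 0.
  have : (Z `&` annihilator J) (z + f2); last by rewrite ZJ.2.
  split; first by apply: ZD => //; exact: nuZ.
  by move=> k Jk; have := gJ k Jk; rewrite f1E dualDE (Jw k Jk) addr0.
have : 1 + e <= nrm (g (x + y, x)).
  have <- : re_part (g (x + y, x)) = 1 + e; last exact: re_part_le_nrm.
  apply: (gG ((x + y, x), 1 + e)).
  exists 1, 0; rewrite of_real1 !scale1r !add0r mul1r.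
  by split=> //; exact: Jsub.1.
have -> : g (x + y, x) = w x + z y.
  rewrite gE /= f1E dualDE !bopDr (Jw y Jy) addr0 addrC addrA addrA.
  rewrite -[f2 x + z x]/((f2 + z) x) [f2 + z]addrC zf2 add0r addrC.
  by [].
have f11 : nrm f1 <= 1.
  by rewrite nrm_bop; apply: opnorm_leM => // t; rewrite mul1r.
have: nrm (w x + z y) <= 1.
  rewrite (le_trans _ f11)// f1E L_sum// addrC.
  rewrite (le_trans (ler_nrmD _ _))// lerD//.
    by apply: le_trans (le_opnorm z y) _; rewrite nrm_bop ler_piMr// opnorm_ge0.
  by apply: le_trans (le_opnorm w x) _; rewrite nrm_bop ler_piMr// opnorm_ge0.
lra.
Qed.

End M_ideal_ball.

(** * Limits along filters and ultrafilters *)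

Section filter_limits.
Context {R : realType} {s : scalar_kind}.
Local Notation K := (scalars R s).

Lemma ltr_of_real (a b : R) : (of_real a < of_real b :> K) = (a < b).
Proof. by rewrite !lt_neqAle ler_of_real (inj_eq (can_inj of_realK)). Qed.

(** Norm convergence with real error bounds; the norm of the library takes its
    values in the scalars. *)
Definition tends (T : Type) (F : set_system T) (V : normedZmodType K)
    (h : T -> V) (l : V) :=
  forall e : R, 0 < e -> \forall t \near F, nrm (h t - l) < e.

Lemma tends_cvg (T : Type) {F : set_system T} {FF : Filter F}
    (V : normedModType K) (h : T -> V) (l : V) : tends F h l <-> h @ F --> l.
Proof.
split=> [hl|/cvgrPdistC_lt hl e e0].
  apply/cvgrPdistC_lt => e e0; have := hl (nrm e).
  have -> : 0 < nrm e by rewrite -ltr_of_real of_real0 of_real_id ?ltW.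
  move=> /(_ isT); apply: filterS => t.
  by rewrite -ltr_of_real of_real_id ?ltW// nrmE.
have := hl (of_real e); rewrite -of_real0 ltr_of_real => /(_ e0).
by apply: filterS => t; rewrite -nrmE ltr_of_real.
Qed.

Lemma ultra_fmap (T U : Type) (F : set_system T) (h : T -> U) :
  UltraFilter F -> UltraFilter (h @ F).
Proof.
move=> FU; split=> [|G GF FG]; first exact: fmap_proper_filter.
apply/seteqP; split=> // A GA.
have [//|FnA] := in_ultra_setVsetC (h @^-1` A) FU.
have GnA : G (~` A) by apply: FG.
by have [t []] := filter_ex (filterI GA GnA).
Qed.

Lemma ultra_compact (T : Type) (F : set_system T) (U : topologicalType)
    (A : set U) (h : T -> U) : UltraFilter F -> compact A ->
  (\forall t \near F, A (h t)) -> exists2 l, A l & h @ F --> l.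
Proof.
move=> FU; rewrite compact_ultra => Aco FA.
by have [l [Al hl]] := Aco _ (ultra_fmap h FU) FA; exists l.
Qed.

Lemma ultra_real (T : Type) (F : set_system T) (h : T -> R) (M : R) :
  UltraFilter F -> (\forall t \near F, `|h t| <= M) ->
  exists l : R, forall e, 0 < e -> \forall t \near F, `|h t - l| < e.
Proof.
move=> FU hM.
have [|l _ /cvgrPdistC_lt hl] :=
  ultra_compact FU (segment_compact (a := - M) (b := M)) (h := h).
  by apply: filterS hM => t; rewrite ler_norml /= in_itv.
by exists l.
Qed.

(** Bounded scalars converge along ultrafilters: the real and the imaginary
    parts do. *)
Lemma ultra_scalar (T : Type) (F : set_system T) (h : T -> K) (M : R) :
  UltraFilter F -> (\forall t \near F, nrm (h t) <= M) ->
  exists l : K, tends F h l.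
Proof.
move=> FU; rewrite /tends /nrm /re_part; move: h; case: s => /= h hM.
  exact: ultra_real hM.
have [a ha] : exists l : R, forall e, 0 < e ->
    \forall t \near F, `|complex.Re (h t) - l| < e.
  apply: ultra_real; apply: filterS hM => t; apply: le_trans.
  by have := normc_ge_Re (h t); rewrite lecE /= => /andP[].
have [b hb] : exists l : R, forall e, 0 < e ->
    \forall t \near F, `|complex.Im (h t) - l| < e.
  apply: ultra_real; apply: filterS hM => t; apply: le_trans.
  case: (h t) => c d /=; rewrite -sqrtr_sqr ler_sqrt ?addr_ge0 ?sqr_ge0//.
  by rewrite lerDr sqr_ge0.
exists (a +i* b)%C => e e0; have e20 : 0 < e / 2 by rewrite divr_gt0.
near=> t.
have hat : `|complex.Re (h t) - a| < e / 2 by near: t; exact: ha.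
have hbt : `|complex.Im (h t) - b| < e / 2 by near: t; exact: hb.
case: (h t) hat hbt => c d /= hat hbt.
rewrite (@le_lt_trans _ _ (`|c - a| + `|d - b|))//; last by lra.
rewrite -[leRHS]ger0_norm ?addr_ge0// -sqrtr_sqr ler_sqrt ?sqr_ge0//.
rewrite [leRHS]sqrrD !real_normK ?num_real// addrAC lerDl.
by rewrite mulrn_wge0// mulr_ge0.
Unshelve. all: by end_near. Qed.

Lemma tends_scale (T : Type) {F : set_system T} {FF : Filter F}
    (V : normedModType K) (h : T -> K) (l : K) (v : V) :
  tends F h l -> tends F (fun t => h t *: v) (l *: v).
Proof.
move=> hl e e0; have v0 : 0 < nrm v + 1 by rewrite ltr_wpDl ?nrm_ge0.
have := hl (e / (nrm v + 1)); rewrite divr_gt0// => /(_ isT).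
apply: filterS => t; rewrite ltr_pdivlMr// -scalerBl nrmZ; apply: le_lt_trans.
by rewrite ler_wpM2l ?nrm_ge0// lerDl.
Qed.

Lemma tends_bop (T : Type) {F : set_system T} {FF : Filter F}
    (V W : normedModType K) (h : T -> V) (l : V) (S : bop V W) :
  tends F h l -> tends F (fun t => S (h t)) (S l).
Proof.
move=> hl e e0; have S0 : 0 < opnorm S + 1 by rewrite ltr_wpDl ?opnorm_ge0.
have := hl (e / (opnorm S + 1)); rewrite divr_gt0// => /(_ isT).
apply: filterS => t; rewrite ltr_pdivlMr// -bopBr mulrC; apply: le_lt_trans.
by rewrite (le_trans (le_opnorm S _))// ler_wpM2r ?nrm_ge0// lerDl.
Qed.

Lemma tends_unique (T : Type) {F : set_system T} {FF : ProperFilter F}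
    (V : normedZmodType K) (h : T -> V) (l m : V) :
  tends F h l -> tends F h m -> l = m.
Proof.
move=> hl hm; apply/eqP; rewrite -subr_eq0; apply/eqP/nrm0_eq0/eqP.
rewrite eq_le nrm_ge0 andbT; apply/ler_addgt0Pl => e e0; rewrite addr0.
have e20 : 0 < e / 2 by rewrite divr_gt0.
have [t [hlt hmt]] := filter_ex (filterI (hl _ e20) (hm _ e20)).
have -> : l - m = (h t - m) - (h t - l) by rewrite opprB [RHS]addrC addrA subrK.
by rewrite (le_trans (ler_nrmD _ _))// nrmN; lra.
Qed.

Lemma tends_nrm_le (T : Type) {F : set_system T} {FF : ProperFilter F}
    (V : normedZmodType K) (h : T -> V) (l : V) (M : R) :
  tends F h l -> (\forall t \near F, nrm (h t) <= M) -> nrm l <= M.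
Proof.
move=> hl hM; apply/ler_addgt0Pl => e e0.
have [t [hlt hMt]] := filter_ex (filterI (hl _ e0) hM).
have -> : l = h t - (h t - l) by rewrite opprB [RHS]addrC subrK.
by rewrite (le_trans (ler_nrmD _ _))// nrmN addrC lerD// ltW.
Qed.

End filter_limits.

(** * Compact operators *)

Section compact_operators.
Context {R : realType} {s : scalar_kind}.
Local Notation K := (scalars R s).
Implicit Types V W Y : normedModType K.

Lemma compact_opI V W (S : bop V W) (A : set W) : compact A ->
  (forall x, nrm x <= 1 -> A (S x)) -> @compact_ops R s V W S.
Proof.
move=> Aco SA; apply: (subclosed_compact _ Aco); first exact: closed_closure.
have /closure_id -> : closed A.
  by apply: compact_closed => //; exact: norm_hausdorff.
by apply: closure_subset => _ [x x1 <-]; exact: SA.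
Qed.

(** The definition of compactness speaks of the unit ball; the family is scaled
    into it by a bound [N] that is positive whatever [M] is. *)
Lemma compact_op_tends V W (S : bop V W) (T : Type) (F : set_system T)
    (h : T -> V) (M : R) : UltraFilter F -> @compact_ops R s V W S ->
  (\forall t \near F, nrm (h t) <= M) -> exists l, tends F (fun t => S (h t)) l.
Proof.
move=> FU Sco hM; pose N := `|M| + 1.
have N0 : 0 < N by rewrite ltr_wpDl.
have [|l _ hl] := ultra_compact FU Sco (h := fun t => S (of_real N^-1 *: h t)).
  apply: filterS hM => t ht; apply: subset_closure.
  exists (of_real N^-1 *: h t) => //=.
  rewrite nrmZ nrm_of_real gtr0_norm ?invr_gt0// mulrC ler_pdivrMr// mul1r.
  by rewrite (le_trans ht)// (le_trans (ler_norm M))// lerDl.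
exists (of_real N *: l) => e e0.
move/tends_cvg: hl => /(_ (e / N)); rewrite divr_gt0// => /(_ isT).
apply: filterS => t; rewrite ltr_pdivlMr// mulrC.
rewrite -{1}(gtr0_norm N0) -(nrm_of_real (s := s)) -nrmZ scalerBr -bopZr.
by rewrite scalerA -of_realM mulfV ?gt_eqF// of_real1 scale1r.
Qed.

(** The image of the ball lies in the multiples [c *: w] with bounded [c];
    bounded scalars converge along ultrafilters. *)
Lemma rank_one_compact V W (f : dual V) (w : W) :
  @compact_ops R s V W (rank_one f w).
Proof.
pose A := [set c *: w | c in [set c : K | nrm c <= opnorm f]].
apply: (@compact_opI _ _ _ A); last first.
  move=> x x1; exists (f x) => //=; exact: le_opnorm_ball.
rewrite compact_ultra => F FU FA.
have /choice[c cP] : forall y, exists c : K,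
    A y -> nrm c <= opnorm f /\ c *: w = y.
  move=> y; have [[c c1 cy]|nAy] := pselect (A y); first by exists c.
  by exists 0.
have cF : \forall y \near F, nrm (c y) <= opnorm f.
  by apply: filterS FA => y /cP[].
have [l cl] := ultra_scalar FU cF.
exists (l *: w); split; first by exists l => //=; exact: tends_nrm_le cl cF.
have : tends F (fun y => c y *: w) (l *: w) by exact: tends_scale.
move=> /tends_cvg cvgF B /cvgF; rewrite /= /nbhs /=.
by move=> FB; apply: filterS2 FA FB => y /cP[_ cy]; rewrite /= cy.
Qed.

Lemma compact_op0 V W : @compact_ops R s V W 0.
Proof.
have -> : (0 : bop V W) = rank_one 0 0.
  by apply: bop_ext => x; rewrite rank_oneE scaler0.
exact: rank_one_compact.
Qed.

Lemma bop_continuous V W (S : bop V W) : continuous S.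
Proof.
move=> x; apply/tends_cvg; apply: (tends_bop (h := id)).
by apply/tends_cvg; exact: cvg_id.
Qed.

Lemma compact_op_compl V W Y (S : bop W Y) (C : bop V W) :
  @compact_ops R s V W C -> @compact_ops R s V Y (bcomp S C).
Proof.
pose A := S @` closure (C @` [set x | nrm x <= 1]).
move=> Cco; apply: (@compact_opI _ _ _ A).
  apply: continuous_compact => //; apply: continuous_subspaceT.
  exact: bop_continuous.
by move=> x x1; exists (C x) => //; apply: subset_closure; exists x.
Qed.

Lemma compact_op_compr V W Y (C : bop W Y) (S : bop V W) : opnorm S <= 1 ->
  @compact_ops R s W Y C -> @compact_ops R s V Y (bcomp C S).
Proof.
move=> S1 Cco; apply: (@compact_opI _ _ _ _ Cco) => x x1.
apply: subset_closure; exists (S x) => //=.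
by rewrite (le_trans (le_opnorm_ball S x1)).
Qed.

End compact_operators.

(** * Compact approximations of the identity *)

Section compact_approximation.
Context {R : realType} {s : scalar_kind}.
Local Notation K := (scalars R s).
Implicit Types V W Y : normedModType K.

Lemma opnorm_bcomp V W Y (S : bop W Y) (T : bop V W) :
  opnorm (bcomp S T) <= opnorm S * opnorm T.
Proof.
apply: opnorm_leM => [|x]; first by rewrite mulr_ge0 ?opnorm_ge0.
rewrite bcompE (le_trans (le_opnorm S _))// -mulrA.
by rewrite ler_wpM2l ?opnorm_ge0 ?le_opnorm.
Qed.

Lemma opnorm0 V W : opnorm (0 : bop V W) = 0.
Proof. by rewrite -nrm_bop nrm0. Qed.

Lemma opnorm_gt V W (T : bop V W) (r : R) : r < opnorm T ->
  exists2 x, nrm x <= 1 & r < nrm (T x).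
Proof.
move=> rT; apply: contrapT => nx; move: rT; apply/negP; rewrite -leNgt.
apply: opnorm_le => x x1; rewrite leNgt; apply/negP => rTx.
by apply: nx; exists x.
Qed.

Definition bid V : bop V V.
Proof.
refine (@Bop _ _ _ _ id _); apply: bounded_linearP => //.
by exists 1 => x; rewrite mul1r.
Defined.

Lemma opnorm_bid V : opnorm (bid V) <= 1.
Proof. by apply: opnorm_le. Qed.

Section tame_seminorms.
Variable V : normedModType K.
Variable Z : set (dual (bop V V)).
Hypothesis Zsub : is_subspace Z.
Hypothesis ZJ : direct_sum Z (annihilator (@compact_ops R s V V)).
Hypothesis L_sum : forall z w, Z z -> annihilator (@compact_ops R s V V) w ->
  nrm (z + w) = nrm z + nrm w.

(** Let [h] be a functional of norm [1 / nrm v] with [h v = 1]. The rank-one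
    operator sending [x] to [h x *: t v] agrees with [t] at [v], and its
    norm is at most that of [t]. *)
Lemma tame_eval (c : R) (v : V) : 0 <= c ->
  tame Z (fun t : bop V V => c * nrm (t v)).
Proof.
move=> c0; apply: (tame_lift ZJ L_sum).
- split=> [x y|a x]; first by rewrite -mulrDr ler_wpM2l// ler_nrmD.
  by rewrite bopZE nrmZ mulrCA.
- exists (c * nrm v) => t; rewrite -mulrA ler_wpM2l// mulrC nrm_bop.
  exact: le_opnorm.
move=> t e e0; have [v0|v0] := eqVneq (nrm v) 0.
  exists 0; split; first exact: compact_op0.
    by rewrite subr0 (nrm0_eq0 v0) bop0r nrm0 mulr0.
  by rewrite nrm0 mulr_ge0 ?nrm_ge0// addr_ge0 ?ltW.
have vgt0 : 0 < nrm v by rewrite lt0r v0 nrm_ge0.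
have [h h1 hv] := norming_functional v.
exists (rank_one (of_real (nrm v)^-1 *: h) (t v)); split.
- exact: rank_one_compact.
- rewrite bopBE rank_oneE bopZE hv.
  rewrite -[X in X *: t v]/(of_real (nrm v)^-1 * of_real (nrm v)).
  by rewrite -of_realM mulVf// of_real1 scale1r subrr nrm0 mulr0.
- rewrite nrm_bop (le_trans (opnorm_rank_one _ _))//.
  rewrite -nrm_bop nrmZ nrm_of_real gtr0_norm ?invr_gt0//.
  apply: (@le_trans _ _ ((nrm v)^-1 * (opnorm t * nrm v))).
    rewrite -mulrA ler_wpM2l ?invr_ge0 ?nrm_ge0// -[leRHS]mul1r.
    by rewrite ler_pM ?nrm_ge0 ?le_opnorm// nrm_bop.
  by rewrite mulrCA mulVf// mulr1 -nrm_bop ler_peMl ?nrm_ge0// lerDl ltW.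
Qed.

(** Let [f x = 1] with [nrm x] close to [1 / opnorm f]. The rank-one
    operator sending [y] to [f (t y) *: x] agrees with [t] after composition
    with [f], and its norm is almost at most that of [t]. *)
Lemma tame_comp (c : R) (f : dual V) : 0 <= c ->
  tame Z (fun t : bop V V => c * opnorm (bcomp f t)).
Proof.
move=> c0; apply: (tame_lift ZJ L_sum).
- split=> [x y|a x].
    rewrite -mulrDr ler_wpM2l// -!nrm_bop.
    have -> : bcomp f (x + y) = bcomp f x + bcomp f y.
      by apply: bop_ext => u; rewrite bopDE !bcompE bopDE bopDr.
    exact: ler_nrmD.
  have -> : bcomp f (a *: x) = a *: bcomp f x.
    by apply: bop_ext => u; rewrite bopZE !bcompE bopZE bopZr.
  by rewrite -!nrm_bop nrmZ mulrCA.
- exists (c * opnorm f) => t; rewrite -mulrA ler_wpM2l// nrm_bop.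
  exact: opnorm_bcomp.
move=> t e e0; have [f0|f0] := eqVneq (opnorm f) 0.
  exists 0; split; first exact: compact_op0.
    apply/eqP; rewrite eq_le mulr_ge0 ?opnorm_ge0// andbT subr0.
    by rewrite (le_trans (ler_wpM2l c0 (opnorm_bcomp _ _)))// f0 mul0r mulr0.
  by rewrite nrm0 mulr_ge0 ?nrm_ge0// addr_ge0 ?ltW.
have fgt0 : 0 < opnorm f by rewrite lt0r f0 opnorm_ge0.
have e1 : 0 < 1 + e by rewrite addr_gt0.
have [x x1 fx] : exists2 x, nrm x <= 1 & opnorm f / (1 + e) < nrm (f x).
  by apply: opnorm_gt; rewrite ltr_pdivrMr// ltr_pMr// ltrDl.
have fxgt0 : 0 < nrm (f x) by rewrite (lt_trans _ fx)// divr_gt0.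
pose a : K := f x.
have a0 : a != 0.
  by apply: contraTneq fxgt0; rewrite /a => ->; rewrite nrm0 ltxx.
exists (rank_one (bcomp f t) (a^-1 *: x)); split.
- exact: rank_one_compact.
- suff -> : bcomp f (t - rank_one (bcomp f t) (a^-1 *: x)) = 0.
    by rewrite opnorm0 mulr0.
  apply: bop_ext => y; rewrite bcompE bopBE bopBr rank_oneE !bopZr bcompE.
  apply/eqP; rewrite subr_eq0; apply/eqP.
  by rewrite -[RHS]/((f (t y) : K) * (a^-1 * a)) mulVf// mulr1.
rewrite nrm_bop (le_trans (opnorm_rank_one _ _))// nrmZ.
have -> : nrm a^-1 = (nrm (f x))^-1.
  apply: (mulIf (x := nrm a)); first by rewrite gt_eqF.
  by rewrite -nrmM !mulVf// ?nrm1// gt_eqF.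
rewrite mulrA (le_trans (ler_piMr _ x1))//.
  by rewrite divr_ge0 ?opnorm_ge0 ?nrm_ge0.
rewrite ler_pdivrMr// (le_trans (opnorm_bcomp _ _))// nrm_bop.
rewrite [leRHS]mulrAC ler_wpM2r ?opnorm_ge0//.
by move/ltW: fx; rewrite ler_pdivrMr// mulrC.
Qed.

Lemma tame_sum (c : R) (v : V) (fs : seq (dual V)) : 0 <= c ->
  exists2 nu : bop V V -> R, tame Z nu &
    forall t : bop V V, c * nrm (t v) <= nu t /\
    forall f, f \in fs -> c * opnorm (bcomp f t) <= nu t.
Proof.
move=> c0; elim: fs => [|f fs [nu nut nule]].
  by exists (fun t => c * nrm (t v)) => //; exact: tame_eval.
exists (fun t => c * opnorm (bcomp f t) + nu t).
  by apply: tameD => //; exact: tame_comp.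
move=> t; have [tv tfs] := nule t; split.
  by rewrite (le_trans tv)// lerDr mulr_ge0 ?opnorm_ge0.
move=> g; rewrite inE => /predU1P[->|/tfs gfs].
  by rewrite lerDl seminorm_ge0//; case: nut.
by rewrite (le_trans gfs)// lerDr mulr_ge0 ?opnorm_ge0.
Qed.

End tame_seminorms.

(** The only form in which the M-ideal hypothesis is used below. It is the
    ball property at the identity operator, with side conditions that make
    [C] nearly fix [v] and its adjoint nearly fix the members of [fs]. *)
Lemma compact_approximation V (S : bop V V) (v : V) (fs : seq (dual V))
    (e : R) :
  M_ideal (@compact_ops R s V V) -> @compact_ops R s V V S -> opnorm S <= 1 ->
  0 < e -> exists C, [/\ @compact_ops R s V V C,
    forall t, nrm (t + S t - C t) <= (1 + e) * nrm t, nrm (v - C v) < e &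
    forall f, f \in fs -> forall t, nrm (f (t - C t)) <= e * nrm t].
Proof.
move=> [_ Jsub [Z [Zsub ZJ L_sum]]] Sco S1 e0.
(* With this weight, [c * r < 1 + e] means [r < e]. *)
pose c := (1 + e) / e.
have e10 : 0 < 1 + e by rewrite addr_gt0.
have cgt0 : 0 < c by rewrite divr_gt0.
have [nu nut nule] := tame_sum Zsub ZJ L_sum v fs (ltW cgt0).
have [||C Cco Cle] :=
  M_ideal_ball Jsub Zsub ZJ L_sum nut Sco _ _ e0 (x := bid V).
- by rewrite nrm_bop.
- by rewrite nrm_bop opnorm_bid.
have [nuv nuf] := nule (bid V - C).
have nu0 : 0 <= nu (bid V - C) by apply: seminorm_ge0; case: nut.
have nu1 : nu (bid V - C) < 1 + e.
  by rewrite (le_lt_trans _ Cle)// lerDr nrm_ge0.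
have ce (r : R) : c * r <= nu (bid V - C) -> r < e.
  move=> /le_lt_trans /(_ nu1); rewrite mulrC /c mulrA ltr_pdivrMr//.
  by rewrite mulrC ltr_pM2l.
exists C; split=> //.
- move=> t; rewrite -[t + S t - C t]/((bid V + S - C) t).
  rewrite (le_trans (le_opnorm _ _))// ler_wpM2r ?nrm_ge0// -nrm_bop.
  by rewrite (le_trans _ (ltW Cle))// lerDl.
- by apply: ce; rewrite -[v - C v]/((bid V - C) v).
- move=> f ffs t; rewrite -[f _]/(bcomp f (bid V - C) t).
  rewrite (le_trans (le_opnorm _ _))// ler_wpM2r ?nrm_ge0// ltW//.
  by apply: ce; exact: nuf.
Qed.

End compact_approximation.

(** * Norms on the plane and real limits *)

Section pnorm_facts.
Context {R : realType}.
Variable p : R.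
Hypothesis p1 : 1 < p.
Implicit Types u v : R.

Let p0 : 0 < p. Proof. exact: lt_trans p1. Qed.

Lemma pnormu0 u : 0 <= u -> pnorm p u 0 = u.
Proof.
move=> u0; rewrite /pnorm powR0 ?gt_eqF// addr0 -powRrM mulfV ?gt_eqF//.
by rewrite powRr1.
Qed.

Lemma pnorm0v v : 0 <= v -> pnorm p 0 v = v.
Proof. by move=> v0; rewrite /pnorm addrC -[RHS]pnormu0. Qed.

Let ltr_powRp u v : 0 <= u -> u < v -> u `^ p < v `^ p.
Proof.
move=> u0 uv; have v0 : 0 <= v by rewrite (le_trans u0) ?ltW.
exact: (gt0_ltr_powR p0 u0 v0 uv).
Qed.

Let ler_powRp u v : 0 <= u -> u <= v -> u `^ p <= v `^ p.
Proof.
by move=> u0; rewrite le_eqVlt => /predU1P[->//|uv]; rewrite ltW ?ltr_powRp.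
Qed.

Lemma le_pnormE u v u' v' :
  (pnorm p u v <= pnorm p u' v') = (u `^ p + v `^ p <= u' `^ p + v' `^ p).
Proof.
rewrite -(pnorm_powR u v p1) -(pnorm_powR u' v' p1).
have := pnorm_ge0 p u v; have := pnorm_ge0 p u' v'.
move: (pnorm p u v) (pnorm p u' v') => x y y0 x0.
apply/idP/idP => [|le]; first exact: ler_powRp.
by rewrite leNgt; apply: contraL le => yx; rewrite -ltNge ltr_powRp.
Qed.

Lemma pnorm_gtr u v : 0 < u -> 0 <= v -> v < pnorm p u v.
Proof.
move=> u0 v0; rewrite ltNge -[leRHS]pnorm0v// le_pnormE.
by rewrite powR0 ?gt_eqF// lerD2r -ltNge powR_gt0.
Qed.

Lemma pnorm_le_sum u v : 0 <= u -> 0 <= v -> pnorm p u v <= u + v.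
Proof.
move=> u0 v0; rewrite -{2}(pnormu0 u0) -{2}(pnorm0v v0).
rewrite -{1}(addr0 u) -{1}(add0r v).
exact: ler_pnormD.
Qed.

Lemma pnorm_ger u v : 0 <= u -> 0 <= v -> v <= pnorm p u v.
Proof.
move=> u0 v0; rewrite -{1}(pnorm0v v0); apply: le_pnorm => //.
  by rewrite lexx.
by rewrite v0 /=.
Qed.

Lemma pnorm_shift u v u' v' a b : 0 <= u -> 0 <= v -> 0 <= u' -> 0 <= v' ->
  0 <= a -> 0 <= b -> u <= u' + a -> v <= v' + b ->
  pnorm p u v <= pnorm p u' v' + (a + b).
Proof.
move=> u0 v0 u'0 v'0 a0 b0 uu' vv'.
have le1 : pnorm p u v <= pnorm p (u' + a) (v' + b).
  by apply: (le_pnorm p1); apply/andP.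
apply: (le_trans le1); apply: (le_trans (ler_pnormD p1 u'0 v'0 a0 b0)).
by rewrite lerD2l; exact: pnorm_le_sum.
Qed.

Lemma pnorm_rigid u v u' v' : 0 <= u <= u' -> 0 <= v <= v' ->
  pnorm p u' v' <= pnorm p u v -> u = u' /\ v = v'.
Proof.
move=> /andP[u0 uu'] /andP[v0 vv']; rewrite le_pnormE => le.
have leu := ler_powRp u0 uu'; have lev := ler_powRp v0 vv'.
split; apply/eqP; rewrite eq_le ?uu' ?vv' leNgt; apply/negP.
  by move=> /(ltr_powRp u0); lra.
by move=> /(ltr_powRp v0); lra.
Qed.

Lemma le_of_small (x y c : R) : 0 <= c ->
  (forall e, 0 < e <= 1 -> x <= y + e * c) -> x <= y.
Proof.
move=> c0 xy; apply/ler_addgt0Pl => e e0.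
pose d := Num.min 1 (e / (c + 1)).
have c10 : 0 < c + 1 by rewrite ltr_wpDl.
have d0 : 0 < d by rewrite lt_min ltr01 divr_gt0.
rewrite (le_trans (xy d _))//; first by rewrite d0 ge_min lexx.
rewrite addrC lerD2r (@le_trans _ _ (d * (c + 1)))//.
  by rewrite ler_pM2l// lerDl.
by rewrite -ler_pdivlMr// ge_min lexx orbT.
Qed.

End pnorm_facts.

Section real_limits.
Context {R : realType}.
Variables (I : Type) (F : set_system I).
Implicit Types (phi psi : I -> R) (l m : R).

Definition rtends phi l :=
  forall e, 0 < e -> \forall t \near F, `|phi t - l| < e.

Lemma rtends_le phi psi l m : ProperFilter F -> rtends phi l -> rtends psi m ->
  (\forall t \near F, phi t <= psi t) -> l <= m.
Proof.
move=> FF hl hm hle; apply/ler_addgt0Pl => e e0.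
have e20 : 0 < e / 2 by rewrite divr_gt0.
have [t [[]]] := filter_ex (filterI (filterI (hl _ e20) (hm _ e20)) hle).
by rewrite !ltr_norml => /andP[? ?] /andP[? ?] ?; lra.
Qed.

Lemma rtends_unique phi l m : ProperFilter F -> rtends phi l -> rtends phi m ->
  l = m.
Proof.
move=> FF hl hm; apply/eqP; rewrite eq_le.
by rewrite (rtends_le _ hl hm) ?(rtends_le _ hm hl)//; exact: nearW.
Qed.

Lemma rtends_cst l : Filter F -> rtends (fun=> l) l.
Proof. by move=> FF e e0; apply: nearW => t; rewrite subrr normr0. Qed.

Lemma rtendsM phi l c : Filter F -> rtends phi l ->
  rtends (fun t => c * phi t) (c * l).
Proof.
move=> FF hl e e0; have c0 : 0 < `|c| + 1 by rewrite ltr_wpDl.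
have := hl (e / (`|c| + 1)); rewrite divr_gt0// => /(_ isT).
apply: filterS => t; rewrite ltr_pdivlMr// mulrC -mulrBr normrM.
by apply: le_lt_trans; rewrite ler_wpM2r// lerDl.
Qed.

End real_limits.

(** * Weak limits and the sum of two copies of a space *)

Section weak_limits.
Context {R : realType} {s : scalar_kind}.
Local Notation K := (scalars R s).
Implicit Types V W : normedModType K.

Definition weakly_tends (I : Type) (F : set_system I) V (h : I -> V) (x : V) :=
  forall f : dual V, tends F (fun t => f (h t)) (f x).

Lemma nrmBC V (x y : V) : nrm (x - y) = nrm (y - x).
Proof. by rewrite -nrmN opprB. Qed.

Lemma nrmB_ge V (x y : V) : nrm x - nrm y <= nrm (x - y).
Proof. by rewrite lerBlDr (le_trans _ (ler_nrmD _ _))// subrK. Qed.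

Lemma weakly_tends_comp (I : Type) (F : set_system I) V W (h : I -> V) x
  (S : bop V W) : weakly_tends F h x -> weakly_tends F (fun t => S (h t)) (S x).
Proof. by move=> hx f; exact: (hx (bcomp f S)). Qed.

(** Compact operators turn weak convergence along ultrafilters into norm
    convergence: a norm limit exists, and functionals identify it. *)
Lemma compact_op_weakly_tends (I : Type) (F : set_system I) V W (h : I -> V) x M
  (C : bop V W) : UltraFilter F -> @compact_ops R s V W C ->
  (\forall t \near F, nrm (h t) <= M) -> weakly_tends F h x ->
  tends F (fun t => C (h t)) (C x).
Proof.
move=> FU Cco hM hx; have [l hl] := compact_op_tends FU Cco hM.
suff <- : l = C x by [].
apply/eqP; rewrite -subr_eq0; apply/eqP/nrm0_eq0/eqP.
rewrite eq_le nrm_ge0 andbT; apply: nrm_le_functionals => f f1.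
rewrite bopBr; suff -> : f l = f (C x) by rewrite subrr nrm0.
apply: (@tends_unique _ _ _ F _ _ (fun t => f (C (h t)))).
  exact: tends_bop.
exact: weakly_tends_comp.
Qed.

End weak_limits.

Section psum_operators.
Context {R : realType} {s : scalar_kind}.
Local Notation K := (scalars R s).
Variables (p : R) (p1 : 1 < p) (X : normedModType K).
Local Notation Z := (psum p1 X X).

Lemma nrm_pair (x y : X) : nrm ((x, y) : Z) = pnorm p (nrm x) (nrm y).
Proof. exact: of_realK. Qed.

Lemma nrm_pairx0 (x : X) : nrm ((x, 0) : Z) = nrm x.
Proof. by rewrite nrm_pair nrm0 pnormu0 ?nrm_ge0. Qed.

Lemma nrm_pair0x (x : X) : nrm ((0, x) : Z) = nrm x.
Proof. by rewrite nrm_pair nrm0 pnorm0v ?nrm_ge0. Qed.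

Lemma nrm_snd_le (z : Z) : nrm z.2 <= nrm z.
Proof.
by case: z => x y; rewrite nrm_pair; apply: pnorm_ger; rewrite ?nrm_ge0.
Qed.

Lemma nrm_fst_le (z : Z) : nrm z.1 <= nrm z.
Proof.
case: z => x y; rewrite nrm_pair /pnorm addrC.
by apply: (pnorm_ger p1); rewrite ?nrm_ge0.
Qed.

Definition psum_inr : bop X Z.
Proof.
refine (@Bop _ _ _ _ (fun x => (0, x) : Z) _); apply: bounded_linearP.
  move=> c x y; rewrite -[RHS]/((c *: 0 + 0, c *: x + y) : Z).
  by rewrite scaler0 addr0.
by exists 1 => x; rewrite nrm_pair0x mul1r.
Defined.

Definition psum_fst : bop Z X.
Proof.
refine (@Bop _ _ _ _ (fun z : Z => z.1) _); apply: bounded_linearP => //.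
by exists 1 => z; rewrite mul1r nrm_fst_le.
Defined.

Definition psum_snd : bop Z X.
Proof.
refine (@Bop _ _ _ _ (fun z : Z => z.2) _); apply: bounded_linearP => //.
by exists 1 => z; rewrite mul1r nrm_snd_le.
Defined.

Lemma opnorm_psum_inr : opnorm psum_inr <= 1.
Proof. by apply: opnorm_leM => // x; rewrite mul1r nrm_pair0x. Qed.

Lemma opnorm_psum_fst : opnorm psum_fst <= 1.
Proof. by apply: opnorm_leM => // z; rewrite mul1r nrm_fst_le. Qed.

Lemma opnorm_psum_snd : opnorm psum_snd <= 1.
Proof. by apply: opnorm_leM => // z; rewrite mul1r nrm_snd_le. Qed.

Lemma opnorm_functional_comp (V W : normedModType K) (f : dual W)
    (S : bop V W) :
  opnorm f <= 1 -> opnorm S <= 1 -> opnorm (bcomp f S) <= 1.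
Proof.
by move=> f1 S1; rewrite (le_trans (opnorm_bcomp _ _))// mulr_ile1 ?opnorm_ge0.
Qed.

End psum_operators.

(** * Limit distances of a bounded family *)

Lemma telescope3 (V : zmodType) (a b c d e l : V) :
  a + c - l = (a - b + c - (d - e) + (d - l)) + (b - e).
Proof.
rewrite [RHS]addrAC [a - b + c]addrAC; set y := a + c.
have -> : y - b - (d - e) + (b - e) = y - d.
  by rewrite addrAC subrKA opprB subrKA.
by rewrite subrKA.
Qed.

Lemma telescope2 (V : zmodType) (a b c d e : V) :
  b + c = (a + c + b - (d + e)) + (d - a) + e.
Proof.
rewrite -[RHS]addrA [d - a + e]addrAC addrA subrK.
by rewrite -[a + c + b]addrA addrC addKr addrC.
Qed.

Lemma le_opnorm_bound (R : realType) (s : scalar_kind)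
    (V W : normedModType (scalars R s)) (S : bop V W) (x : V) :
  opnorm S <= 1 -> nrm (S x) <= nrm x.
Proof.
by move=> S1; rewrite (le_trans (le_opnorm S x))// ler_piMl ?nrm_ge0.
Qed.

Section error_terms.
Context {R : realType}.
Implicit Types x y e : R.

Lemma near_leD x y e : `|x - y| < e -> y <= x + e.
Proof. by rewrite ltr_norml => /andP[? ?]; lra. Qed.

Lemma near_geD x y e : `|x - y| < e -> x <= y + e.
Proof. by rewrite ltr_norml => /andP[? ?]; lra. Qed.

Lemma dist_lower_bound e n x d N : 0 < e -> e <= 1 -> 0 <= x -> x <= d + e ->
  n <= (1 + e) * x + (e + e) ->
  n + (e + e + e * N + e) <= d + e * (d + N + 8).
Proof. by move=> e0 e1 x0 xd nx; nra. Qed.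

Lemma dist_upper_bound e q z n d : 0 < e -> e <= 1 -> 0 <= q -> z <= q + e ->
  d <= n + e -> n <= (1 + e) * z + (e + e) -> d <= q + e * (q + 5).
Proof. by move=> e0 e1 q0 zq dn nz; nra. Qed.

End error_terms.

Section property_Mp_limits.
Context {R : realType} {s : scalar_kind}.
Local Notation K := (scalars R s).
Variables (p : R) (p1 : 1 < p) (X : normedModType K).
Local Notation Z := (psum p1 X X).
Hypothesis XMp : property_Mp p1 X.
Variables (I : Type) (F : set_system I) (h : I -> X) (M : R).
Hypothesis FU : UltraFilter F.
Hypothesis hM : \forall t \near F, nrm (h t) <= M.

Let inr2 : bop X Z := psum_inr p1 X.
Let fst2 : bop Z X := psum_fst p1 X.
Let snd2 : bop Z X := psum_snd p1 X.

Let triangle4 (a b c : Z) : nrm (a + b + c) <= nrm a + nrm b + nrm c.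
Proof. by rewrite (le_trans (ler_nrmD _ _))// lerD2r ler_nrmD. Qed.

Lemma ultra_dist a : exists d, rtends F (fun t => nrm (h t - a)) d.
Proof.
apply: (ultra_real (M := M + nrm a)); apply: filterS hM => t ht.
rewrite ger0_norm ?nrm_ge0// (le_trans (ler_nrmD _ _))//.
by rewrite nrmN lerD2r.
Qed.

(** Let [S] send [(x, y)] to [(g y *: u, 0)], with [u] a unit vector on
    which the norming functional [f] is 1, and let [C] approximate the
    identity of [Z] relative to [S], to [(0, a)] and to [f] on the first
    summand. Let [l] be the limit of [C (0, h t)]. Applied to [(0, h t -
    a)], the operator [1 + S - C] gives nearly [(g (h t - a) *: u - l.1, h t
    - l.2)]. Since [f l.1] is nearly the limit of [f] at the first component
    of [(0, h t)], hence nearly 0, the first component has norm at least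
    about [nrm (c - g a)]; that of the second one is in the limit [D l.2],
    which is at least [D0]. *)
Lemma dist_lower (D : X -> R) (D0 : R) (g : dual X) (c : K) (a : X) :
  (forall b, rtends F (fun t => nrm (h t - b)) (D b)) ->
  0 <= D0 -> (forall b, D0 <= D b) ->
  opnorm g <= 1 -> tends F (fun t => (g (h t) : K)) c ->
  pnorm p (nrm (c - g a : K)) D0 <= D a.
Proof.
move=> hD D00 D0D g1 hg; set G := nrm (c - g a : K).
have G0 : 0 <= G by exact: nrm_ge0.
have Da0 : 0 <= D a by exact: le_trans (D0D a).
have [Geq0|Gneq0] := eqVneq G 0; first by rewrite Geq0 pnorm0v.
have Ggt0 : 0 < G by rewrite lt0r Gneq0 G0.
(* A unit vector exists because [g] does not vanish. *)
have [u [f [u1 f1 fu]]] : exists (u : X) (f : dual X),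
    [/\ nrm u = 1, opnorm f <= 1 & f u = 1 :> K].
  have [t gt] := filter_ex (hg _ Ggt0).
  pose x := h t - a.
  have x0 : nrm x != 0.
    apply/eqP => /nrm0_eq0 x0; have /eqP := bop0r g.
    rewrite -x0 bopBr subr_eq0 => /eqP gta.
    by move: gt; rewrite gta nrmBC ltxx.
  have xgt0 : 0 < nrm x by rewrite lt0r x0 nrm_ge0.
  have [f f1 fx] := norming_functional x.
  exists (of_real (nrm x)^-1 *: x), f; split=> //.
    by rewrite nrmZ nrm_of_real gtr0_norm ?invr_gt0// mulVf.
  rewrite bopZr fx -[LHS]/(of_real (nrm x)^-1 * of_real (nrm x)).
  by rewrite -of_realM mulVf// of_real1.
pose N := `|M|.
have N0 : 0 <= N by exact: normr_ge0.
apply: (le_of_small (c := D a + N + 8)) => [|e /andP[e0 e1]].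
  by rewrite !addr_ge0.
pose S := rank_one (bcomp g snd2) ((u, 0) : Z).
have S1 : opnorm S <= 1.
  rewrite (le_trans (opnorm_rank_one _ _))// nrm_pairx0 u1 mulr1.
  exact: opnorm_functional_comp (opnorm_psum_snd p1 X).
have Sco : @compact_ops R s Z Z S by exact: rank_one_compact.
have [C [Cco CS Ca Cf]] :=
  compact_approximation ((0, a) : Z) [:: bcomp f fst2] XMp Sco S1 e0.
have {}Cf z : nrm (f (z - C z).1) <= e * nrm z.
  by apply: (Cf (bcomp f fst2)); rewrite inE.
have [l hl] : exists l, tends F (fun t => C (inr2 (h t))) l.
  apply: (compact_op_tends (M := M)) => //.
  by apply: filterS hM => t; rewrite nrm_pair0x.
have [t [[[[Ct gt] at_] l2t] Mt]] := filter_ex (filterI (filterI (filterI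
  (filterI (hl _ e0) (hg _ e0)) (hD a _ e0)) (hD l.2 _ e0)) hM).
have {}Ct : nrm (C (inr2 (h t)) - l) < e := Ct.
have {}gt : nrm (g (h t) - c :> K) < e := gt.
have {}at_ : `|nrm (h t - a) - D a| < e := at_.
have {}l2t : `|nrm (h t - l.2) - D l.2| < e := l2t.
pose x := h t - a; pose r : K := g x.
pose q : Z := (r *: u - l.1, h t - l.2).
have q_le : nrm q <= (1 + e) * nrm x + (e + e).
  have -> : q = ((inr2 x + S (inr2 x) - C (inr2 x)) + (C (inr2 (h t)) - l)) +
      (inr2 a - C (inr2 a)).
    have -> : C (inr2 x) = C (inr2 (h t)) - C (inr2 a) by rewrite -!bopBr.
    have -> : inr2 x = inr2 (h t) - inr2 a by rewrite -bopBr.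
    have -> : S (inr2 (h t) - inr2 a) = ((r *: u, 0) : Z).
      rewrite -bopBr rank_oneE; congr pair; exact: scaler0.
    have -> : q = inr2 (h t) + ((r *: u, 0) : Z) - l.
      by congr pair; rewrite /= ?add0r ?addr0.
    move: (inr2 (h t)) (inr2 a) ((r *: u, 0) : Z) => A B E.
    exact: telescope3.
  apply: (le_trans (triangle4 _ _ _)); rewrite -[leLHS]addrA; apply: lerD.
    by rewrite (le_trans (CS _))// nrm_pair0x.
  exact: lerD (ltW Ct) (ltW Ca).
have fl : nrm (f l.1 : K) <= e + e * N.
  have -> : f l.1 = f (l.1 - (C (inr2 (h t))).1) + f (C (inr2 (h t))).1.
    by rewrite -bopDr subrK.
  rewrite (le_trans (ler_nrmD _ _))//; apply: lerD.
    rewrite (le_trans (le_opnorm_bound _ f1))// nrmBC.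
    have le1 : nrm ((C (inr2 (h t))).1 - l.1) <= nrm (C (inr2 (h t)) - l).
      exact: (nrm_fst_le (C (inr2 (h t)) - l)).
    exact: le_trans le1 (ltW Ct).
  rewrite -nrmN -[- _]add0r -(bop0r f) -bopBr.
  rewrite (le_trans (Cf (inr2 (h t))))// ler_wpM2l ?(ltW e0)// nrm_pair0x.
  exact: le_trans Mt (ler_norm M).
have Gq : G <= nrm q.1 + (e + e + e * N).
  have -> : G = nrm (r - (g (h t) - c : K)).
    by congr nrm; rewrite /r /x bopBr opprB [RHS]addrC addrA subrK.
  rewrite (le_trans (ler_nrmD _ _))// nrmN.
  have -> : nrm q.1 + (e + e + e * N) = nrm q.1 + (e + e * N) + e by ring.
  apply: lerD (ltW gt).
  have -> : r = f q.1 + f l.1.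
    by rewrite -bopDr subrK bopZr fu; exact/esym/mulr1.
  by rewrite (le_trans (ler_nrmD _ _))// lerD// le_opnorm_bound.
have Dq : D0 <= nrm q.2 + e by exact: le_trans (D0D l.2) (near_leD l2t).
have eeN : 0 <= e + e + e * N by rewrite !addr_ge0 ?mulr_ge0 ?(ltW e0).
have := pnorm_shift p1 G0 D00 (nrm_ge0 q.1) (nrm_ge0 q.2) eeN (ltW e0) Gq Dq.
rewrite -nrm_pair => /le_trans; apply.
exact: dist_lower_bound e0 e1 (nrm_ge0 x) (near_geD at_) q_le.
Qed.

(** Let [S] move [u = x - a] from the first summand to the second one, and
    let [C] approximate the identity relative to [S] and to [(u, 0)]. Since
    [C (0, h t - x)] tends to 0, the operator [1 + S - C] sends [(u, h t -
    x)] nearly to [(0, u + h t - x)], which is [(0, h t - a)]. *)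
Lemma dist_upper (x a : X) (dx da : R) : weakly_tends F h x ->
  rtends F (fun t => nrm (h t - x)) dx ->
  rtends F (fun t => nrm (h t - a)) da -> da <= pnorm p (nrm (x - a)) dx.
Proof.
move=> hx hdx hda; pose u := x - a.
have dx0 : 0 <= dx.
  apply: (rtends_le _ (rtends_cst 0 _) hdx); apply: nearW => t.
  exact: nrm_ge0.
have [u0|u0] := eqVneq (nrm u) 0.
  rewrite -/u u0 pnorm0v//; suff -> : da = dx by [].
  apply: (rtends_unique _ hda); suff -> : a = x by [].
  by apply/esym/eqP; rewrite -subr_eq0; apply/eqP/nrm0_eq0.
have ugt0 : 0 < nrm u by rewrite lt0r u0 nrm_ge0.
have [f f1 fu] := norming_functional u.
pose g : dual X := of_real (nrm u)^-1 *: f.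
have gu : g u = 1 :> K.
  rewrite bopZE fu -[LHS]/(of_real (nrm u)^-1 * of_real (nrm u)).
  by rewrite -of_realM mulVf// of_real1.
pose u1 : Z := (u, 0); pose u2 : Z := (0, u).
pose S := rank_one (bcomp g fst2) u2.
have S1 : opnorm S <= 1.
  have g1 : opnorm g <= (nrm u)^-1.
    rewrite -nrm_bop nrmZ nrm_of_real gtr0_norm ?invr_gt0//.
    by rewrite ler_piMr// ?invr_ge0 ?nrm_ge0// nrm_bop.
  have gf : opnorm (bcomp g fst2) <= (nrm u)^-1.
    apply: le_trans (opnorm_bcomp _ _) _; rewrite -[leRHS]mulr1.
    by apply: ler_pM (opnorm_ge0 _) (opnorm_ge0 _) g1 (opnorm_psum_fst p1 X).
  apply: le_trans (opnorm_rank_one _ _) _; rewrite nrm_pair0x.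
  by rewrite -ler_pdivlMr// mul1r.
have Sco : @compact_ops R s Z Z S by exact: rank_one_compact.
have P0 : 0 <= pnorm p (nrm u) dx by exact: pnorm_ge0.
apply: (le_of_small (c := pnorm p (nrm u) dx + 5)) => [|e /andP[e0 e1]].
  exact: addr_ge0.
have [C [Cco CS Cu _]] := compact_approximation u1 [::] XMp Sco S1 e0.
have Cx : tends F (fun t => C (inr2 (h t))) (C (inr2 x)).
  have CJ : @compact_ops R s X Z (bcomp C inr2).
    exact: compact_op_compr (opnorm_psum_inr p1 X) Cco.
  exact: (compact_op_weakly_tends FU CJ hM hx).
have [t [[Ct dxt] dat]] :=
  filter_ex (filterI (filterI (Cx _ e0) (hdx _ e0)) (hda _ e0)).
have {}Ct : nrm (C (inr2 (h t)) - C (inr2 x)) < e := Ct.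
have {}dxt : `|nrm (h t - x) - dx| < e := dxt.
have {}dat : `|nrm (h t - a) - da| < e := dat.
pose y := h t - x; pose z : Z := (u, y).
have z_le : nrm z <= pnorm p (nrm u) dx + e.
  rewrite nrm_pair -[X in _ + X]add0r.
  apply: (pnorm_shift p1 (nrm_ge0 _) (nrm_ge0 _) (nrm_ge0 _) dx0 (lexx 0)
    (ltW e0)).
    by rewrite addr0.
  exact: near_geD dxt.
have : nrm (h t - a) <= (1 + e) * nrm z + (e + e).
  have yE : inr2 (h t - a) = (z + S z - C z) + (C u1 - u1) + (C (inr2 y)).
    have -> : S z = u2.
      by rewrite rank_oneE bcompE gu scale1r.
    have zE : z = u1 + inr2 y by congr pair; rewrite /= ?addr0 ?add0r.
    have -> : inr2 (h t - a) = u2 + inr2 y.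
      rewrite -[u2]/(inr2 u) -bopDr; congr (inr2 _).
      by rewrite /u /y [RHS]addrC addrA subrK.
    by rewrite zE (bopDr C) -telescope2.
  rewrite -(nrm_pair0x p1) -[X in nrm X]/(inr2 (h t - a)) yE.
  apply: (le_trans (triangle4 _ _ _)); rewrite -[leLHS]addrA; apply: lerD.
    exact: CS.
  apply: lerD; first by rewrite nrmBC; exact: ltW Cu.
  by rewrite bopBr bopBr; exact: ltW Ct.
exact: dist_upper_bound e0 e1 P0 z_le (near_leD dat).
Qed.

End property_Mp_limits.


(** * Weak compactness of balls *)

Lemma le0_of_harmonic (R : realType) (y k : R) : 0 <= k ->
  (forall n, y <= k * n.+1%:R^-1) -> y <= 0.
Proof.
move=> k0 yk; apply: (le_of_small (c := k)) => // e /andP[e0 _].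
have [n ne] := ltr_add_invr e0; rewrite add0r in ne.
by rewrite add0r (le_trans (yk n))// mulrC ler_wpM2r// ltW.
Qed.

Section weak_compactness.
Context {R : realType} {s : scalar_kind}.
Local Notation K := (scalars R s).
Variables (p : R) (p1 : 1 < p) (X : completeNormedModType K).
Hypothesis XMp : property_Mp p1 X.

Lemma weakly_tends_ball (I : Type) (F : set_system I) (V : normedModType K)
    (h : I -> V) (x : V) :
  (forall g : dual V, opnorm g <= 1 -> tends F (fun t => g (h t)) (g x)) ->
  Filter F -> weakly_tends F h x.
Proof.
move=> hx FF f e e0; pose k := opnorm f + 1.
have k0 : 0 < k by rewrite ltr_wpDl ?opnorm_ge0.
pose g : dual V := of_real k^-1 *: f.
have g1 : opnorm g <= 1.
  rewrite -nrm_bop nrmZ nrm_of_real gtr0_norm ?invr_gt0// mulrC.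
  by rewrite ler_pdivrMr// mul1r nrm_bop lerDl.
have fg y : f y = of_real k *: g y.
  by rewrite bopZE scalerA -of_realM mulfV ?gt_eqF// of_real1 scale1r.
clearbody g; move: (hx g g1 (e / k)); rewrite divr_gt0// => /(_ isT).
apply: filterS => t.
rewrite ltr_pdivlMr// (fg (h t)) (fg x) -scalerBr nrmZ nrm_of_real.
by rewrite gtr0_norm// mulrC.
Qed.

(** Let [D b] be the limit distance of the family to [b]. At a point [b]
    that almost minimizes [D], every functional of norm at most 1 nearly
    takes its limit value along the family, by [dist_lower]. Hence
    minimizing sequences are Cauchy, and their limit [x] is the weak limit.
    As [D] is continuous it attains its infimum at [x], so that [dist_lower]
    becomes the stated inequality. *)
Lemma weak_limit (I : Type) (F : set_system I) (h : I -> X) (M : R) :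
  UltraFilter F -> (\forall t \near F, nrm (h t) <= M) ->
  exists2 x, weakly_tends F h x & forall a dx da,
    rtends F (fun t => nrm (h t - x)) dx ->
    rtends F (fun t => nrm (h t - a)) da -> pnorm p (nrm (x - a)) dx <= da.
Proof.
move=> FU hM; have /choice[D hD] := ultra_dist FU hM.
have Dge0 b : 0 <= D b.
  apply: (rtends_le _ (rtends_cst 0 _) (hD b)); apply: nearW => t.
  exact: nrm_ge0.
pose D0 := inf (range D).
have rangeD : range D !=set0 by exists (D 0), 0.
have lbD : has_lbound (range D) by exists 0 => _ [b _ <-].
have D00 : 0 <= D0 by apply: lb_le_inf => // _ [b _ <-].
have D0D b : D0 <= D b by apply: ge_inf => //; exists b.
pose eta n : R := n.+1%:R^-1.
have eta0 n : 0 < eta n by rewrite invr_gt0.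
have /choice[a aD] : forall n, exists b, D b < pnorm p (eta n) D0.
  move=> n; have [_ [b _ <-] lt] := inf_lt rangeD (pnorm_gtr p1 (eta0 n) D00).
  by exists b.
have hlim (g : dual X) : opnorm g <= 1 ->
    exists c : K, tends F (fun t => (g (h t) : K)) c.
  move=> g1; apply: (ultra_scalar (M := M)); apply: filterS hM => t.
  exact: le_trans (le_opnorm_bound _ g1).
have close (g : dual X) c n : opnorm g <= 1 ->
    tends F (fun t => (g (h t) : K)) c -> nrm (c - g (a n) : K) <= eta n.
  move=> g1 gc; rewrite leNgt; apply/negP => lt.
  have le1 := dist_lower XMp FU hM (a n) hD D00 D0D g1 gc.
  have le2 : pnorm p (eta n) D0 <= pnorm p (nrm (c - g (a n) : K)) D0.
    by apply: (le_pnorm p1); apply/andP; split=> //; exact: ltW.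
  by have := lt_le_trans (aD n) (le_trans le2 le1); rewrite ltxx.
have aa n m : nrm (a n - a m) <= eta n + eta m.
  apply: nrm_le_functionals => g g1; have [c gc] := hlim g g1.
  have -> : g (a n - a m) = (c - g (a m) : K) - (c - g (a n)).
    by rewrite bopBr opprB [RHS]addrC subrKA.
  by rewrite (le_trans (ler_nrmD _ _))// nrmN addrC lerD// close.
have aan n m : (n <= m)%N -> nrm (a m - a n) <= 2 * eta n.
  move=> nm; apply: le_trans (aa m n) _.
  rewrite mulr_natl mulr2n lerD2r /eta lef_pV2 ?posrE ?ltr0n// ler_nat ltnS.
  exact: nm.
have cva : cvg (a @ \oo).
  apply/cauchy_cvgP; apply: cauchy_exP => e e0.
  have e'0 : 0 < nrm e / 2.
    by rewrite divr_gt0// -(ltr_of_real (s := s)) of_real0 of_real_id ?ltW.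
  have [n] := ltr_add_invr e'0; rewrite add0r => ne.
  exists (a n); exists n => // m /= nm; rewrite -ball_normE /= -nrmE.
  rewrite -[e]of_real_id ?ltW// ltr_of_real nrmBC.
  by rewrite (le_lt_trans (aan n m nm))// mulrC -ltr_pdivlMr.
have [x ax] : exists x : X, a n @[n --> \oo] --> x by exact/cvg_ex.
have xa n : nrm (x - a n) <= 2 * eta n.
  have ta : tends \oo (fun m => a m - a n) (x - a n).
    move/tends_cvg: ax => ax e e0; apply: filterS (ax e e0) => m.
    by rewrite opprB addrA subrK.
  by apply: (tends_nrm_le ta); exists n => // m /= nm; exact: aan.
have gx (g : dual X) : opnorm g <= 1 -> tends F (fun t => g (h t)) (g x).
  move=> g1; have [c gc] := hlim g g1; suff <- : c = g x by [].
  apply/eqP; rewrite -subr_eq0; apply/eqP/nrm0_eq0/eqP.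
  rewrite eq_le nrm_ge0 andbT; apply: (le0_of_harmonic (k := 3)) => // n.
  have -> : c - g x = (c - g (a n)) - g (x - a n) :> K.
    by rewrite bopBr opprB subrKA.
  rewrite (le_trans (ler_nrmD _ _))// nrmN.
  have -> : (3 * n.+1%:R^-1 = eta n + 2 * eta n :> R) by rewrite /eta; ring.
  rewrite lerD ?close//.
  by apply: le_trans (xa n); exact: le_opnorm_bound.
exists x; first exact: weakly_tends_ball.
have Dx : D x <= D0.
  rewrite -subr_le0; apply: (le0_of_harmonic (k := 3)) => // n.
  have : D x <= D (a n) + 2 * eta n.
    have hDn : rtends F (fun t => nrm (h t - a n) + 2 * eta n)
        (D (a n) + 2 * eta n).
      move=> e e0; apply: filterS (hD (a n) _ e0) => t.
      by rewrite opprD addrACA subrr addr0.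
    apply: (rtends_le _ (hD x) hDn); apply: nearW => t.
    have -> : h t - x = (h t - a n) - (x - a n).
      by rewrite opprB addrA subrK.
    by rewrite (le_trans (ler_nrmD _ _))// nrmN lerD2l.
  have := le_trans (ltW (aD n)) (pnorm_le_sum p1 (ltW (eta0 n)) D00).
  rewrite -/(eta n); move: (eta n) (D x) (D (a n)) => ? ? ?; lra.
move=> b dx db hdx hdb.
have -> : db = D b by exact: rtends_unique hdb (hD b).
have -> : dx = D0.
  by rewrite (rtends_unique _ hdx (hD x)); apply/eqP; rewrite eq_le Dx D0D.
have [g g1 gxb] := norming_functional (x - b).
have := dist_lower XMp FU hM b hD D00 D0D g1 (gx g g1).
by rewrite -bopBr gxb nrm_of_real ger0_norm ?nrm_ge0.
Qed.

End weak_compactness.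

(** * Maximizing families and weak cluster points *)

Section maximizing.
Context {R : realType} {s : scalar_kind}.
Local Notation K := (scalars R s).
Variables (p : R) (p1 : 1 < p) (X : completeNormedModType K).
Hypothesis XMp : property_Mp p1 X.
Variable T : bop X X.

Lemma weakly_tends_unique (I : Type) (F : set_system I) (V : normedModType K)
    (h : I -> V) (x y : V) : ProperFilter F ->
  weakly_tends F h x -> weakly_tends F h y -> x = y.
Proof.
move=> FF hx hy; apply/eqP; rewrite -subr_eq0; apply/eqP/nrm0_eq0/eqP.
rewrite eq_le nrm_ge0 andbT; apply: nrm_le_functionals => f _.
by rewrite bopBr (tends_unique (hx f) (hy f)) subrr nrm0.
Qed.

(** In the chain [|T|^p <= |T x|^p + lim |T (h t) - T x|^p <= |T|^p (|x|^p +
    lim |h t - x|^p) <= |T|^p] all terms agree. The first step is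
    [dist_upper] for the images under [T], the last one comes from
    [weak_limit]. *)
Lemma maximizing_weak_limit (I : Type) (F : set_system I) (h : I -> X) x :
  UltraFilter F -> (\forall t \near F, nrm (h t) = 1) ->
  rtends F (fun t => nrm (T (h t))) (opnorm T) -> weakly_tends F h x ->
  nrm (T x) = opnorm T * nrm x /\ exists2 d, 1 - nrm x <= d &
    rtends F (fun t => nrm (h t - x)) d /\
    rtends F (fun t => nrm (T (h t) - T x)) (opnorm T * d).
Proof.
move=> FU h1 hT hx.
have hM : \forall t \near F, nrm (h t) <= 1 by apply: filterS h1 => t ->.
have hTM : \forall t \near F, nrm (T (h t)) <= opnorm T.
  by apply: filterS hM => t; exact: le_opnorm_ball.
have [d hd] := ultra_dist FU hM x; have [c hc] := ultra_dist FU hTM (T x).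
have nge0 (V : normedModType K) (y : V) : 0 <= nrm y by exact: nrm_ge0.
have d0 : 0 <= d.
  by apply: (rtends_le _ (rtends_cst 0 _) hd); apply: nearW => t; exact: nge0.
have c0 : 0 <= c.
  by apply: (rtends_le _ (rtends_cst 0 _) hc); apply: nearW => t; exact: nge0.
have hd1 : 1 - nrm x <= d.
  apply: (rtends_le _ (rtends_cst (1 - nrm x) _) hd); apply: filterS h1 => t <-.
  exact: nrmB_ge.
have lower : pnorm p (nrm x) d <= 1.
  have [y hy ylower] := weak_limit XMp FU hM.
  have xy : x = y by exact: weakly_tends_unique hx hy.
  rewrite -xy in ylower.
  have := ylower 0 d 1 hd; rewrite subr0; apply.
  move=> e e0; apply: filterS h1 => t.
  by rewrite subr0 => ->; rewrite subrr normr0.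
have upper : opnorm T <= pnorm p (nrm (T x)) c.
  have := dist_upper XMp FU hTM (a := 0) (da := opnorm T)
    (weakly_tends_comp T hx) hc; rewrite subr0.
  by apply; move=> e e0; apply: filterS (hT e e0) => t; rewrite subr0.
have cd : c <= opnorm T * d.
  apply: (rtends_le _ hc (rtendsM (opnorm T) _ hd)); apply: nearW => t.
  by rewrite -bopBr le_opnorm.
have T0 := opnorm_ge0 T.
have top : pnorm p (opnorm T * nrm x) (opnorm T * d) <= pnorm p (nrm (T x)) c.
  apply: le_trans upper; rewrite (pnormZ p1 T0 (nge0 _ x) d0).
  exact: ler_piMr.
have bounds : 0 <= nrm (T x) <= opnorm T * nrm x by rewrite nge0 le_opnorm.
have boundc : 0 <= c <= opnorm T * d by rewrite c0.
have [Tx cE] := pnorm_rigid p1 bounds boundc top.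
by split=> //; exists d => //; rewrite -cE.
Qed.

(** A weak cluster point of a maximizing sequence is the weak limit of an
    ultrafilter finer than the image filter of the sequence. Passing to the
    ultrafilter takes the place of the choice of a subsequence. *)
Lemma WC_ultrafilter x : WC T x -> exists F : set_system X,
  [/\ UltraFilter F, \forall t \near F, nrm t = 1,
      rtends F (fun t => nrm (T t)) (opnorm T) & weakly_tends F id x].
Proof.
move=> [u [u1 uT] ux].
have : cluster ((u @ \oo) : set_system (weak X)) x.
  rewrite clusterE => A [k _ kA]; have := ux k I.
  by apply: closure_subset => _ [n kn <-]; exact: kA.
rewrite cluster_cvgE => -[G PG [Gx uG]].
have [F [FU GF]] := ultraFilterLemma PG.
exists F; split=> //.
- by apply: GF; apply: uG; exists 0%N => // n _; exact: u1.
- move=> e e0; apply: GF; apply: uG.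
  by move/cvgrPdistC_lt: uT => /(_ e e0).
have {}Fx : F --> (x : weak X) by exact: cvg_trans GF Gx.
move=> f; apply/tends_cvg.
have /cvg_sup/(_ f) Fxf := Fx.
move=> N fxN; apply: (Fxf (f @^-1` N)).
exact: (@initial_continuous X K^o f x N fxN).
Qed.

Lemma WC_of_ultrafilter (u : nat -> X) (F : set_system nat) x : MS T u ->
  UltraFilter F -> \oo `<=` F -> weakly_tends F u x -> WC T x.
Proof.
move=> uT FU ooF ux; exists u => // k _ N Nx.
have : (u @ F) --> (x : weak X).
  apply/cvg_sup => f.
  move=> A; rewrite nbhsE => -[B [[W Wopen <-] Wfx] WA].
  have /tends_cvg fux := ux f.
  have : F ((fun n => f (u n)) @^-1` W) by apply: fux; exact: open_nbhs_nbhs.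
  have uWA : (fun n => f (u n)) @^-1` W `<=` u @^-1` A by move=> n; exact: WA.
  by move=> FW; exact: (@filterS _ F _ _ _ uWA FW).
move=> /(_ N Nx) FN; have {}FN : F (u @^-1` N) := FN.
have [n [Nn kn]] : exists n, N (u n) /\ (k <= n)%N.
  have Fk : F [set n | (k <= n)%N] by apply: ooF; exists k.
  by have [n []] := filter_ex (filterI FN Fk); exists n.
by exists (u n); split => //; exists n.
Qed.

End maximizing.

(** * Separating and approximating functionals *)

Section separating_functionals.
Context {R : realType} {s : scalar_kind}.
Local Notation K := (scalars R s).

(** Norming functionals of a countable dense set. If they all vanish at [x] and
    [d] in the dense set is close to [x], then [nrm d], the value of the
    functional at [d - x], is small. *)
Lemma separating_sequence (V : normedModType K) : separable V ->
  exists phi : nat -> dual V, forall x, (forall n, phi n x = 0) -> x = 0.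
Proof.
move=> [D /countable_injP[c cinj] Ddense].
have /choice[phi phiP] : forall n, exists f : dual V, opnorm f <= 1 /\
    forall d, D d -> c d = n -> f d = of_real (nrm d) :> K.
  move=> n; have [[d [Dd cd]]|nD] := pselect (exists d, D d /\ c d = n).
    have [f f1 fd] := norming_functional d; exists f; split=> // d' Dd' cd'.
    by rewrite (cinj d' d) ?inE// cd cd'.
  exists 0; split; first by rewrite opnorm0.
  by move=> d Dd cd; exfalso; apply: nD; exists d.
exists phi => x phix; apply: nrm0_eq0; apply/eqP; rewrite eq_le nrm_ge0 andbT.
apply/ler_addgt0Pl => e e0; rewrite addr0.
have e20 : 0 < of_real (e / 2) :> K by rewrite -of_real0 ltr_of_real divr_gt0.
have [||d [xd Dd]] := Ddense (ball x (of_real (e / 2))).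
- by exists x; exact: ballxx.
- exact: ball_open.
have {}xd : nrm (x - d) < e / 2.
  by move: xd; rewrite -ball_normE /= -nrmE ltr_of_real.
have d_le : nrm d <= nrm (x - d).
  have [phi1 phid] := phiP (c d).
  rewrite nrmBC; apply: le_trans (le_opnorm_bound (d - x) phi1).
  rewrite bopBr phix subr0 phid//.
  by rewrite (nrm_of_real (s := s)) ger0_norm ?nrm_ge0.
have -> : x = (x - d) + d by rewrite subrK.
rewrite (le_trans (ler_nrmD _ _))//.
by rewrite [e]splitr lerD ?ltW// (le_lt_trans d_le).
Qed.

(** Any vector can be corrected by a combination of fixed vectors, one for each
    functional, so as to lie in the common kernel. *)
Lemma finite_codimension (V : normedModType K) (fs : seq (dual V)) :
  exists n (e : 'I_n -> V), forall x, exists c : 'I_n -> K,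
    forall f, f \in fs -> f (x - \sum_i c i *: e i) = 0.
Proof.
elim: fs => [|g fs [n [e IH]]].
  by exists 0%N, (fun=> 0) => x; exists (fun=> 0).
have [[w [fw gw]]|nw] :=
    pselect (exists w, (forall f, f \in fs -> f w = 0) /\ g w != 0).
  exists n.+1, (fun i => if unlift ord0 i is Some j then e j else w) => x.
  have [c xc] := IH x; pose y := x - \sum_i c i *: e i.
  pose a : K := (g y : K) / g w.
  exists (fun i => if unlift ord0 i is Some j then c j else a) => f.
  rewrite big_ord_recl unlift_none.
  under eq_bigr do rewrite liftK.
  rewrite opprD addrCA -/y addrC bopBr bopZr inE => /predU1P[->|ffs].
    apply/eqP; rewrite subr_eq0; apply/eqP.
    by rewrite -[RHS]/((g y : K) / g w * g w) divfK.
  by rewrite fw// scaler0 subr0; exact: xc.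
exists n, e => x; have [c xc] := IH x; exists c => f.
rewrite inE => /predU1P[->|]; last exact: xc.
apply/eqP; apply: contrapT => /negP gn0; apply: nw.
by exists (x - \sum_i c i *: e i).
Qed.

Lemma common_zero (V : normedModType K) (fs : seq (dual V)) :
  ~ finite_dimensional V ->
  exists2 z : V, nrm z = 1 & forall f, f \in fs -> f z = 0.
Proof.
move=> infd; have [n [e eP]] := finite_codimension fs.
apply: contrapT => nz; apply: infd; exists n, e => x.
have [c xc] := eP x; exists c; apply/eqP; rewrite -subr_eq0.
apply/negPn/negP => y0; apply: nz; set y := x - _ in xc y0.
have ny0 : nrm y != 0 by apply: contra_neq y0 => /nrm0_eq0.
have ygt0 : 0 < nrm y by rewrite lt0r ny0 nrm_ge0.
exists (of_real (nrm y)^-1 *: y).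
  by rewrite nrmZ nrm_of_real gtr0_norm ?invr_gt0// mulVf.
by move=> f ffs; rewrite bopZr xc// scaler0.
Qed.

End separating_functionals.

(** * Maximizing sequences and the essential norm *)

Section error_choice.
Context {R : realType}.
Implicit Types a d e y : R.

Lemma small_step a e : 0 < a -> 0 < e -> exists d, [/\ 0 < d, d <= a / 2,
  2 * d <= e & d * (1 + a) <= e].
Proof.
move=> a0 e0; have a10 : 0 < 1 + a by rewrite addr_gt0.
exists (Num.min (a / 2) (Num.min (e / 2) (e / (1 + a)))); split.
- by rewrite !lt_min !divr_gt0.
- by rewrite ge_min lexx.
- by rewrite mulrC -ler_pdivlMr// !ge_min lexx orbT.
- by rewrite -ler_pdivlMr// !ge_min lexx !orbT.
Qed.

Lemma almost_maximal_bound a d e y : 0 < a -> 0 < d -> 0 < e -> d <= a / 2 ->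
  d * (1 + a) <= e -> 0 <= y -> y <= 1 + d -> (a - e) * y <= a - d.
Proof.
move=> a0 d0 e0 da de y0 yd; have [ae|ae] := leP (a - e) 0.
  by apply: (@le_trans _ _ 0); [rewrite mulr_le0_ge0|lra].
have : (a - e) * y <= (a - e) * (1 + d) by rewrite ler_pM2l.
have : 0 < e * d by rewrite mulr_gt0.
by lra.
Qed.

End error_choice.

Section essential_norm.
Context {R : realType} {s : scalar_kind}.
Local Notation K := (scalars R s).
Variables (p : R) (p1 : 1 < p) (X : completeNormedModType K).
Hypothesis Xsep : separable X.
Hypothesis XMp : property_Mp p1 X.
Hypothesis Xneq0 : exists x : X, x != 0.
Variable T : bop X X.

Lemma nrm_normalize (y : X) : y != 0 -> exists2 z, nrm z = 1 &
  forall (W : normedModType K) (S : bop X W), nrm (S z) = nrm (S y) / nrm y.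
Proof.
move=> y0; have ny0 : nrm y != 0 by apply: contra_neq y0 => /nrm0_eq0.
have ygt0 : 0 < nrm y by rewrite lt0r ny0 nrm_ge0.
exists (of_real (nrm y)^-1 *: y).
  by rewrite nrmZ nrm_of_real gtr0_norm ?invr_gt0// mulVf.
by move=> W S; rewrite bopZr nrmZ nrm_of_real gtr0_norm ?invr_gt0// mulrC.
Qed.

Lemma exists_almost_maximizing (e : R) : 0 < e ->
  exists2 z : X, nrm z = 1 & opnorm T - e <= nrm (T z).
Proof.
move=> e0; have [x0 x00] := Xneq0; have [z0 z01 _] := nrm_normalize x00.
have [le0|gt0] := leP (opnorm T - e) 0.
  by exists z0 => //; rewrite (le_trans le0)// nrm_ge0.
have [x x1 Tx] : exists2 x, nrm x <= 1 & opnorm T - e < nrm (T x).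
  by apply: opnorm_gt; rewrite gtrBl.
have xneq0 : x != 0.
  by apply: contraTneq (lt_trans gt0 Tx) => ->; rewrite bop0r nrm0 ltxx.
have [z z1 zE] := nrm_normalize xneq0; exists z => //.
rewrite zE (le_trans (ltW Tx))// ler_pdivlMr.
  by rewrite ler_piMr// nrm_ge0.
rewrite lt0r nrm_ge0 andbT; apply: contra_neq xneq0; exact: nrm0_eq0.
Qed.

Lemma MS_of_harmonic (u : nat -> X) : (forall n, nrm (u n) = 1) ->
  (forall n, opnorm T - n.+1%:R^-1 <= nrm (T (u n))) -> MS T u.
Proof.
move=> u1 uT; split=> //; apply/cvgrPdistC_lt => e e0.
have [n] := ltr_add_invr e0; rewrite add0r => ne.
exists n => // m /= nm; have Tm : nrm (T (u m)) <= opnorm T.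
  by apply: le_opnorm_ball; rewrite u1.
rewrite ler0_norm ?subr_le0// opprB (le_lt_trans _ ne)//.
rewrite lerBlDr -lerBlDl (le_trans _ (uT m))// lerD2l lerN2.
by rewrite lef_pV2 ?posrE ?ltr0n// ler_nat.
Qed.

Lemma MS_weak_limit (u : nat -> X) : MS T u ->
  exists x (F : set_system nat),
    [/\ UltraFilter F, \oo `<=` F, weakly_tends F u x & WC T x].
Proof.
move=> uT; have [F [FU ooF]] := ultraFilterLemma (F := \oo) _.
have [|x ux _] := weak_limit XMp FU (h := u) (M := 1).
  by apply: nearW => n; rewrite uT.1.
by exists x, F; split=> //; exact: WC_of_ultrafilter uT FU ooF ux.
Qed.

Lemma WC_nonempty : exists x, WC T x.
Proof.
have /choice[u uP] : forall n, exists z : X, nrm z = 1 /\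
    opnorm T - n.+1%:R^-1 <= nrm (T z).
  move=> n; have n0 : 0 < n.+1%:R^-1 :> R by rewrite invr_gt0.
  by have [z z1 zT] := exists_almost_maximizing n0; exists z.
have uT : MS T u by apply: MS_of_harmonic => n; case: (uP n).
by have [x [F [_ _ _ Wx]]] := MS_weak_limit uT; exists x.
Qed.

Lemma WC_nrm_le1 x : WC T x -> nrm x <= 1.
Proof.
move=> /WC_ultrafilter[F [FU F1 _ Fx]]; apply: nrm_le_functionals => f f1.
apply: (tends_nrm_le (Fx f)); apply: filterS F1 => t t1.
by rewrite (le_trans (le_opnorm_bound _ f1))// t1.
Qed.

Lemma WC_norm_attaining x : WC T x -> x != 0 -> norm_attaining T.
Proof.
move=> /WC_ultrafilter[F [FU F1 FT Fx]] x0.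
have [Tx _] := maximizing_weak_limit XMp FU F1 FT Fx.
have [z z1 zE] := nrm_normalize x0; exists z; first by rewrite z1.
by rewrite zE Tx mulfK//; apply: contra_neq x0 => /nrm0_eq0.
Qed.

Lemma norm_attaining_WC : norm_attaining T -> exists2 x, WC T x & nrm x = 1.
Proof.
move=> [x x1 Tx].
have [z z1 Tz] : exists2 z : X, nrm z = 1 & nrm (T z) = opnorm T.
  have [x0|x0] := eqVneq x 0.
    have [y0 y00] := Xneq0; have [z z1 _] := nrm_normalize y00.
    exists z => //; apply/eqP; rewrite eq_le le_opnorm_ball ?z1//=.
    by rewrite -Tx x0 bop0r nrm0 nrm_ge0.
  have [z z1 zE] := nrm_normalize x0; exists z => //.
  have xgt0 : 0 < nrm x.
    by rewrite lt0r nrm_ge0 andbT; apply: contra_neq x0 => /nrm0_eq0.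
  apply/eqP; rewrite eq_le le_opnorm_ball ?z1//=.
  by rewrite zE Tx ler_pdivlMr// ler_piMr// opnorm_ge0.
exists z => //; have [F [FU ooF]] := ultraFilterLemma (F := \oo) _.
apply: (WC_of_ultrafilter (u := fun=> z) (F := F)) => //.
  by split=> //; rewrite Tz; exact: cvg_cst.
by move=> f e e0; apply: nearW => n; rewrite subrr nrm0.
Qed.

Lemma ess_norm_le : ess_norm T <= opnorm T.
Proof.
apply: ge_inf; first by exists 0 => _ [C _ <-]; exact: opnorm_ge0.
by exists 0; [exact: compact_op0|rewrite subr0].
Qed.

Lemma le_ess_norm (r : R) : (forall C, @compact_ops R s X X C ->
  r <= opnorm (T - C)) -> r <= ess_norm T.
Proof.
move=> rT; apply: lb_le_inf; last by move=> _ [C Cco <-]; exact: rT.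
by exists (opnorm (T - 0)), 0 => //; exact: compact_op0.
Qed.

(** If [nrm x < 1] then [t - x], with [t] a generic point of the
    ultrafilter, does not vanish in the limit. It is weakly null, so that
    compact perturbations of [T] are invisible at it, and up to a factor it
    is maximizing for [T]. *)
Lemma WC_ess_norm x : WC T x -> nrm x < 1 -> opnorm T = ess_norm T.
Proof.
move=> /WC_ultrafilter[F [FU F1 FT Fx]] x1.
have [_ [d xd [hd hTd]]] := maximizing_weak_limit XMp FU F1 FT Fx.
have d0 : 0 < d by apply: lt_le_trans xd; rewrite subr_gt0.
apply/eqP; rewrite eq_le ess_norm_le andbT; apply: le_ess_norm => C Cco.
rewrite -(ler_pM2r d0).
have hM : \forall t \near F, nrm (id t) <= 1 by apply: filterS F1 => t ->.
have hC := compact_op_weakly_tends FU Cco hM Fx.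
have hTC : rtends F (fun t => nrm (T t - T x) - nrm (C t - C x)) (opnorm T * d).
  move=> e e0; have e20 : 0 < e / 2 by rewrite divr_gt0.
  apply: filterS2 (hTd _ e20) (hC _ e20) => t.
  have := nrm_ge0 (C t - C x); rewrite !ltr_norml.
  move: (nrm _) (nrm _) (opnorm T * d) => a b c a0 /andP[? ?] ?.
  by apply/andP; split; lra.
apply: (rtends_le _ hTC (rtendsM (opnorm (T - C)) _ hd)); apply: nearW => t.
apply: le_trans (le_opnorm (T - C) (t - x)).
by rewrite bopBE !bopBr nrmB_ge.
Qed.

(** Smallness at the members of a separating sequence is enough: it forces the
    weak cluster points, which exist by weak compactness, to be 0. *)
Lemma zero_WC : (forall (fs : seq (dual X)) (e : R), 0 < e -> exists z,
    [/\ nrm z = 1, opnorm T - e <= nrm (T z) &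
      forall f, f \in fs -> nrm (f z) <= e]) -> WC T 0.
Proof.
move=> approx; have [phi phi0] := separating_sequence Xsep.
have /choice[u uP] : forall n, exists z, [/\ nrm z = 1,
    opnorm T - n.+1%:R^-1 <= nrm (T z) &
    forall f, f \in [seq phi i | i <- iota 0 n] -> nrm (f z) <= n.+1%:R^-1].
  by move=> n; apply: approx; rewrite invr_gt0.
have uT : MS T u by apply: MS_of_harmonic => n; case: (uP n).
have [x [F [FU ooF ux Wx]]] := MS_weak_limit uT.
suff <- : x = 0 by [].
apply: phi0 => i; apply: (tends_unique (ux (phi i))) => e e0.
have [n] := ltr_add_invr e0; rewrite add0r => ne.
apply: ooF; exists (maxn n i.+1) => // m /=; rewrite geq_max => /andP[nm im].
rewrite subr0; apply: le_lt_trans ne.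
have [_ _ um] := uP m; apply: (le_trans (um (phi i) _)).
  by apply/mapP; exists i => //; rewrite mem_iota.
by rewrite lef_pV2 ?posrE ?ltr0n// ler_nat.
Qed.

(** With [C'] a compact approximation of the identity, [T - T C'] has norm
    at least the essential norm. Hence some [y = x - C' x] satisfies [opnorm
    T - d < nrm (T y)]; it is nearly in the unit ball and nearly annihilated
    by given functionals. If [T = 0] the vector [y] may be small, but then
    any unit vector is maximizing. *)
Lemma ess_norm_zero_WC : (T = 0 -> ~ finite_dimensional X) ->
  opnorm T = ess_norm T -> WC T 0.
Proof.
move=> T0 Tess; apply: zero_WC => fs e e0.
have [Teq0|Tneq0] := eqVneq (opnorm T) 0.
  have [|z z1 fz] := common_zero fs (V := X).
    by apply: T0; apply: nrm0_eq0; rewrite nrm_bop.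
  exists z; split=> [//||f /fz ->]; last by rewrite nrm0 ltW.
  by rewrite Teq0 sub0r (le_trans _ (nrm_ge0 _))// oppr_le0 ltW.
have A0 : 0 < opnorm T by rewrite lt0r Tneq0 opnorm_ge0.
have [d [d0 dA de dAe]] := small_step A0 e0.
have fsP : @compact_ops R s (psum p1 X X) (psum p1 X X) 0 by exact: compact_op0.
have [|C [Cco C1 _ Cf]] := compact_approximation (0 : psum p1 X X)
  [seq bcomp f (psum_snd p1 X) | f <- fs] XMp fsP _ d0.
  by rewrite opnorm0.
pose C' : bop X X := bcomp (psum_snd p1 X) (bcomp C (psum_inr p1 X)).
have C'co : @compact_ops R s X X C'.
  apply: compact_op_compl; apply: compact_op_compr Cco.
  exact: opnorm_psum_inr.
pose i2 := psum_inr p1 X; pose s2 := psum_snd p1 X.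
have C'E t : t - C' t = s2 (i2 t - C (i2 t)) by rewrite bopBr.
clearbody C'.
have C'1 t : nrm (t - C' t) <= (1 + d) * nrm t.
  rewrite C'E; apply: le_trans (le_opnorm_bound _ (opnorm_psum_snd p1 X)) _.
  by have := C1 (i2 t); rewrite addr0 nrm_pair0x.
have C'f f t : f \in fs -> nrm (f (t - C' t)) <= d * nrm t.
  move=> ffs; rewrite C'E -bcompE -(nrm_pair0x p1 t).
  have fs_mem : bcomp f s2 \in [seq bcomp f (psum_snd p1 X) | f <- fs].
    by apply/mapP; exists f.
  exact: (Cf _ fs_mem (i2 t)).
have [x x1 Tx] : exists2 x, nrm x <= 1 &
    opnorm T - d < nrm ((T - bcomp T C') x).
  apply: opnorm_gt; apply: (@lt_le_trans _ _ (opnorm T)).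
    by rewrite gtrBl.
  rewrite {1}Tess; apply: ge_inf.
    by exists 0 => _ [S _ <-]; exact: opnorm_ge0.
  by exists (bcomp T C'); first exact: (compact_op_compl (S := T) C'co).
pose y := x - C' x.
have {}Tx : opnorm T - d < nrm (T y) by rewrite bopBr.
have y1 : nrm y <= 1 + d.
  by rewrite (le_trans (C'1 x))// ler_piMr// addr_ge0// ltW.
have Ty := le_opnorm T y.
have y2 : 2^-1 <= nrm y.
  rewrite -(ler_pM2l A0); apply: le_trans Ty; lra.
have y0 : 0 < nrm y by apply: lt_le_trans y2; rewrite invr_gt0.
have [|z z1 zE] := @nrm_normalize y.
  by apply: contraTneq y0 => ->; rewrite nrm0 ltxx.
exists z; split=> //.
  rewrite zE ler_pdivlMr//; apply: le_trans (ltW Tx).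
  exact: almost_maximal_bound A0 d0 e0 dA dAe (ltW y0) y1.
move=> f ffs; rewrite zE ler_pdivrMr//.
rewrite (le_trans (C'f f x ffs))// (@le_trans _ _ d)//.
  by rewrite ler_piMr// ltW.
by apply: (@le_trans _ _ (e * 2^-1)); [lra|rewrite ler_pM2l].
Qed.

End essential_norm.

(** * Extremal norms of weak cluster points *)

Section extremal_norms.
Context {R : realType} {s : scalar_kind}.
Variables (X : normedModType (scalars R s)) (T : bop X X).
Hypothesis WC_neq0 : exists x, WC T x.
Hypothesis WC_le1 : forall x, WC T x -> nrm x <= 1.

Lemma m_min_ge0 : (0 <= m_min T)%E.
Proof. by apply: le_ereal_inf_tmp => _ [x _ <-]; rewrite lee_fin nrm_ge0. Qed.

Lemma m_min_lt1P : (m_min T < 1)%E <-> exists2 x, WC T x & nrm x < 1.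
Proof.
split=> [/ereal_inf_lt[_ [x Wx <-]]|[x Wx x1]].
  by rewrite lte_fin; exists x.
by apply/ereal_inf_ltP; exists (nrm x)%:E; [exists x|rewrite lte_fin].
Qed.

Lemma m_min_eq0 : WC T 0 -> m_min T = 0%E.
Proof.
move=> W0; apply/eqP; rewrite eq_le m_min_ge0 andbT.
by apply: ereal_inf_lbound; exists 0 => //; rewrite nrm0.
Qed.

Lemma m_min_eq1 : ~ (m_min T < 1)%E <-> m_min T = 1%E.
Proof.
split=> [/negP|->]; last by rewrite ltxx.
rewrite -leNgt => le1; apply/eqP; rewrite eq_le le1 andbT.
have [x Wx] := WC_neq0; apply: (@le_trans _ _ (nrm x)%:E).
  by apply: ereal_inf_lbound; exists x.
by rewrite lee_fin WC_le1.
Qed.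

Lemma m_max_gt0P : (0 < m_max T)%E <-> exists2 x, WC T x & x != 0.
Proof.
split=> [/ereal_sup_gt[_ [x Wx <-]]|[x Wx x0]].
  rewrite lte_fin => x0; exists x => //.
  by apply: contraTneq x0 => ->; rewrite nrm0 ltxx.
apply/ereal_sup_gtP; exists (nrm x)%:E; first by exists x.
by rewrite lte_fin lt0r nrm_ge0 andbT; apply: contra_neq x0 => /nrm0_eq0.
Qed.

Lemma m_max_eq0 : ~ (0 < m_max T)%E <-> m_max T = 0%E.
Proof.
split=> [/negP|->]; last by rewrite ltxx.
rewrite -leNgt => le0; apply/eqP; rewrite eq_le le0 /=.
have [x Wx] := WC_neq0; apply: (@le_trans _ _ (nrm x)%:E).
  by rewrite lee_fin nrm_ge0.
by apply: ereal_sup_ubound; exists x.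
Qed.

Lemma m_max_eq1 x : WC T x -> nrm x = 1 -> m_max T = 1%E.
Proof.
move=> Wx x1; apply/eqP; rewrite eq_le; apply/andP; split.
  by apply: ge_ereal_sup => _ [y Wy <-]; rewrite lee_fin WC_le1.
by apply: ereal_sup_ubound; exists x; rewrite ?x1.
Qed.

End extremal_norms.

(** * The theorem *)

(* The zero operator on a finite-dimensional space is excluded from the two
   parts on m_min, and the zero space is excluded: there they fail. *)
Theorem theorem2p1 (R : realType) (s : scalar_kind) (p : R) (p1 : 1 < p)
    (X : completeNormedModType (scalars R s))
    (Xsep : separable X) (XMp : property_Mp p1 X) (Xneq0 : exists x : X, x != 0)
    (T : bop X X) :
  ((T = 0 -> ~ finite_dimensional X) ->
    ((m_min T < 1)%E <-> m_min T = 0%E) /\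
    (m_min T = 0%E <-> opnorm T = ess_norm T)) /\
  (((0 < m_max T)%E <-> m_max T = 1%E) /\
   (m_max T = 1%E <-> norm_attaining T)) /\
  [/\ ~ norm_attaining T <-> m_max T = 0%E,
      norm_attaining T <-> (0 < m_max T)%E &
      norm_attaining T <-> m_max T = 1%E] /\
  ((T = 0 -> ~ finite_dimensional X) ->
    [/\ opnorm T = ess_norm T <-> (m_min T < 1)%E,
        opnorm T = ess_norm T <-> m_min T = 0%E &
        ess_norm T < opnorm T <-> m_min T = 1%E]) /\
  [/\ ~ norm_attaining T -> opnorm T = ess_norm T,
      ess_norm T < opnorm T -> norm_attaining T &
      exactly_one
        (~ norm_attaining T /\ opnorm T = ess_norm T)
        (norm_attaining T /\ opnorm T = ess_norm T)
        (norm_attaining T /\ ess_norm T < opnorm T)].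
Proof.
have Wne := WC_nonempty XMp Xneq0 T.
have Wle1 := WC_nrm_le1 (T := T).
have max_gt0 : (0 < m_max T)%E <-> norm_attaining T.
  split=> [/m_max_gt0P[x]|/(norm_attaining_WC Xneq0)[x Wx x1]].
    exact: (WC_norm_attaining XMp).
  apply/m_max_gt0P; exists x => //.
  apply/eqP => x0; move: x1; rewrite x0 nrm0 => /eqP.
  by rewrite eq_sym oner_eq0.
have max_eq1 : m_max T = 1%E <-> norm_attaining T.
  split=> [T1|/(norm_attaining_WC Xneq0)[x Wx x1]].
    by apply/max_gt0; rewrite T1 lte01.
  exact: (m_max_eq1 Wle1 Wx x1).
have max_eq0 : m_max T = 0%E <-> ~ norm_attaining T.
  rewrite -(m_max_eq0 Wne); exact: not_iff_compat.
have min_ess : (m_min T < 1)%E -> opnorm T = ess_norm T.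
  by move=> /m_min_lt1P[x Wx x1]; exact: (WC_ess_norm XMp Wx x1).
have ess_lt : ess_norm T < opnorm T <-> opnorm T <> ess_norm T.
  split=> [lt eq|/eqP neq]; first by move: lt; rewrite eq ltxx.
  by rewrite lt_neqAle eq_sym neq ess_norm_le.
have na_ess : ~ norm_attaining T -> opnorm T = ess_norm T.
  move=> nT; apply: min_ess; apply/m_min_lt1P; have [x Wx] := Wne.
  exists x => //; suff -> : x = 0 by rewrite nrm0 ltr01.
  apply/eqP/negPn/negP => x0; apply: nT; exact: (WC_norm_attaining XMp Wx x0).
have min0_lt1 : m_min T = 0%E -> (m_min T < 1)%E by move=> ->; rewrite lte01.
have ess_min0 : (T = 0 -> ~ finite_dimensional X) ->
    opnorm T = ess_norm T -> m_min T = 0%E.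
  by move=> T0 eq; apply: m_min_eq0; exact: (ess_norm_zero_WC Xsep XMp).
split.
  move=> /ess_min0 e0; split; first by split=> [/min_ess/e0|/min0_lt1].
  by split=> [/min0_lt1/min_ess|/e0].
split; first by split=> //; split=> [/max_gt0/max_eq1|->]; rewrite ?lte01.
split; first by split; [split=> /max_eq0|split=> /max_gt0|split=> /max_eq1].
split.
  move=> /ess_min0 e0; split.
  - by split=> [/e0/min0_lt1|/min_ess].
  - by split=> [/e0|/min0_lt1/min_ess].
  - apply: (iff_trans ess_lt); apply: iff_trans (m_min_eq1 Wne Wle1).
    by apply: not_iff_compat; split=> [/e0/min0_lt1|/min_ess].
split=> //; first by move=> /ess_lt h; apply: contrapT => /na_ess.
have [nT|nT] := pselect (norm_attaining T); last first.
  by constructor 1; split; [split=> //; exact: na_ess| |] => -[].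
have [eq|/eqP neq] := eqVneq (opnorm T) (ess_norm T).
  by constructor 2; split=> [[]||[_ /ess_lt]].
by constructor 3; split=> [[]|[]|] //; split=> //; exact/ess_lt.
Qed.
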